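(* (Generalized Majorizing Principle) Let $\chi_0:\mathbb{R}^d\to\mathbb{C}^d$ be a measurable function and $f\in S$. Let $\phi$ be the minimal cascade solution to (nFMS)$_{f(|\chi_0|/2)}$. Suppose that for some $T\in(0,\infty]$, $\phi<\infty$ a.e. on $\mathbb{R}^d\times[0,T)$. Then there exists a subset $D\subset\mathbb{R}^d$ of full measure such that (nFNS)$_{\chi_0}$ has a minimal cascade solution $\chi$ on $D\times[0,T)$ satisfying $|\chi|\le2f^{-1}(\phi)$.
   Context: Class $S$: all functions $f:[0,\infty)\to[0,\infty)$ that are submultiplicative ($f(ab)\le f(a)f(b)$ for all $a,b\ge0$), convex, with $f(0)=0$ and $f\not\equiv0$. (Such $f$ is a continuous increasing bijection of $[0,\infty)$; $f^{-1}$ is its inverse.) Product: for $\xi\in\mathbb{R}^d\setminus\{0\}$, $e_\xi=\xi/|\xi|$, $\pi_{\xi^\perp}a=a-(e_\xi\cdot a)e_\xi$ and $a\odot_\xi b=\frac{-i}{2}\big((e_\xi\cdot b)\pi_{\xi^\perp}a+(e_\xi\cdot a)\pi_{\xi^\perp}b\big)$ for $a,b\in\mathbb{C}^d$ (with $e_\xi\cdot a=\sum_j(e_\xi)_ja_j$). Kernel: $d\ge3$, and $h:\mathbb{R}^d\setminus\{0\}\to(0,\infty)$ is a fixed standard majorizing kernel, i.e. a measurable function with $(h*h)(\xi)=|\xi|h(\xi)$ for all $\xi\ne0$. $H(\eta|\xi)=\frac{h(\eta)h(\xi-\eta)}{|\xi|h(\xi)}$, a probability density in $\eta\in\mathbb{R}^d$.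 Cascade: $\mathbb{T}=\{0\}\cup\bigcup_{n\ge1}\{1,2\}^n$ is the binary tree with root $0$; $|v|$ is the generation of $v$ ($|0|=0$), $v|j$ is the truncation of $v$ to generation $j$ ($v|0=0$), and $v1,v2$ are the children of $v$ (the children of the root being $1,2$). For each $\xi\ne0$, on a probability space with measure $\mathbb{P}_\xi$ (expectation $\mathbb{E}_\xi$) there are families $\{W_v\}_{v\in\mathbb{T}}$, $\{T_v\}_{v\in\mathbb{T}}$ such that: (i) $W_0=\xi$; (ii) given $W_v$, $T_v$ is exponentially distributed with mean $|W_v|^{-2}$, $W_{v1}$ is independent of $T_v$ with density $H(\cdot|W_v)$, and $W_{v2}=W_v-W_{v1}$; (iii) given $W_{v1}$ and $W_{v2}$, the sub-families (of $W$'s and $T$'s) indexed by the subtrees rooted at $v1$ and $v2$ are independent of each other (and are cascades started at $W_{v1}$, $W_{v2}$). The explosion time is $\zeta=\zeta_\xi=\sup_{n\ge0}\min_{|v|=n}\sum_{j=0}^nT_{v|j}$. Processes: $\mathbf{X}(\xi,t)=\mathbf{X}_0(t)$ where $\mathbf{X}_v(s)=\chi_0(W_v)$ if $T_v\ge s$ and $\mathbf{X}_v(s)=\mathbf{X}_{v1}(s-T_v)\odot_{W_v}\mathbf{X}_{v2}(s-T_v)$ if $T_v<s$. For measurable $\psi_0:\mathbb{R}^d\to[0,\infty]$, $\mathbf{Y}=\mathbf{Y}_{\psi_0}$ is defined by the same recursion with $\chi_0$ replaced by $\psi_0$ and $\odot_{W_v}$ replaced by multiplication of numbers. On $[\zeta>t]$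 these recursions terminate after finitely many steps, so $\mathbf{X}\mathbbm{1}_{\zeta>t}$, $\mathbf{Y}\mathbbm{1}_{\zeta>t}$ are well defined ($0$ off $[\zeta>t]$). Equations: (nFNS)$_{\chi_0}$ is $$\chi(\xi,t)=e^{-t|\xi|^2}\chi_0(\xi)+\int_0^te^{-s|\xi|^2}|\xi|^2\int_{\mathbb{R}^d}\chi(\eta,t-s)\odot_\xi\chi(\xi-\eta,t-s)H(\eta|\xi)\,d\eta\,ds$$ and (nFMS)$_{\psi_0}$ is the scalar equation $$\psi(\xi,t)=e^{-t|\xi|^2}\psi_0(\xi)+\int_0^te^{-s|\xi|^2}|\xi|^2\int_{\mathbb{R}^d}\psi(\eta,t-s)\psi(\xi-\eta,t-s)H(\eta|\xi)\,d\eta\,ds .$$ The minimal cascade solution to (nFMS)$_{\psi_0}$ is $\mathbb{E}_\xi[\mathbf{Y}_{\psi_0}\mathbbm{1}_{\zeta>t}]\in[0,\infty]$. The minimal cascade solution to (nFNS)$_{\chi_0}$ is $\chi(\xi,t)=\mathbb{E}_\xi[\mathbf{X}\mathbbm{1}_{\zeta>t}]$; saying that it exists on a set means that $\mathbb{E}_\xi[|\mathbf{X}|\mathbbm{1}_{\zeta>t}]<\infty$ there (and $\chi$ then satisfies (nFNS)$_{\chi_0}$ there). A set has full measure if its complement is Lebesgue null. *)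

(* Defs.v *)
From HB Require Import structures.
From mathcomp Require Import all_boot all_order all_algebra.
From mathcomp Require Import all_classical all_reals all_analysis.
From mathcomp Require Import measurable_realfun.
From mathcomp Require Export complex.

Set Implicit Arguments.
Unset Strict Implicit.
Unset Printing Implicit Defensive.

Import Order.TTheory GRing.Theory Num.Theory.
Import numFieldNormedType.Exports.

Local Open Scope classical_set_scope.
Local Open Scope ring_scope.

(* An alias, so that the sigma-algebra below is attached to real vectors only. *)
Definition Rd (R : realType) (d : nat) := 'rV[R]_d.
HB.instance Definition _ (R : realType) (d : nat) :=
  GRing.Lmodule.on (Rd R d).
HB.instance Definition _ (R : realType) (d : nat) :=
  isPointed.Build (Rd R d) 0.

Definition coord (R : realType) (d : nat) (i : 'I_d) (x : Rd R d) : R :=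
  (x : 'rV[R]_d) 0 i.

Section Rd_measurable.
Context {R : realType} {d : nat}.

(* The product (Borel) sigma-algebra of R^d, as the library does for tuples. *)
Definition Rd_sigma : set_system (Rd R d) :=
  g_sigma_preimage (@coord R d : 'I_d -> Rd R d -> measurableTypeR R).

Let Rd_sigma0 : Rd_sigma set0. Proof. exact: sigma_algebra0. Qed.
Let Rd_sigmaC A : Rd_sigma A -> Rd_sigma (~` A).
Proof. exact: sigma_algebraC. Qed.
Let Rd_sigma_bigcup (F : (set (Rd R d))^nat) :
  (forall i, Rd_sigma (F i)) -> Rd_sigma (\bigcup_i (F i)).
Proof. exact: sigma_algebra_bigcup. Qed.

HB.instance Definition _ := @isMeasurable.Build default_measure_display
  (Rd R d) Rd_sigma Rd_sigma0 Rd_sigmaC Rd_sigma_bigcup.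

Lemma measurable_coord (i : 'I_d) :
  measurable_fun [set: Rd R d] (@coord R d i : _ -> R).
Proof.
move=> _ B mB; rewrite setTI; apply: sub_sigma_algebra.
by rewrite -bigcup_seq; exists i => /=; [exact: mem_index_enum|exists B; rewrite ?setTI].
Qed.

Lemma measurable_fun_coordP d' (S : measurableType d') (f : S -> Rd R d) :
  measurable_fun [set: S] f <->
  forall i, measurable_fun [set: S] (coord i \o f : S -> R).
Proof.
split=> [mf i|mf]; first by apply: measurableT_comp => //; exact: measurable_coord.
have sub : measurable `<=` [set A : set (Rd R d) | measurable (f @^-1` A)].
  apply: smallest_sub.
    split=> /= [|A|F mF]; rewrite ?preimage_set0//.
      by rewrite setTD -preimage_setC => ?; exact: measurableC.
    by rewrite preimage_bigcup; exact: bigcup_measurable.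
  rewrite -bigcup_seq => A [i _ [B mB <-]] /=; rewrite setTI.
  by have := mf i measurableT _ mB; rewrite setTI.
by move=> _ A mA; rewrite setTI; exact: sub.
Qed.

End Rd_measurable.

Section lebesgue_Rd.
Context {R : realType}.

Definition Rd_cons d (p : measurableTypeR R * Rd R d) : Rd R d.+1 :=
  \row_i (if unlift ord0 i is Some j then coord j p.2 else p.1).

Lemma measurable_Rd_cons d : measurable_fun setT (@Rd_cons d).
Proof.
apply/measurable_fun_coordP => i.
case: (unliftP ord0 i) => [j ->|->].
  have -> : coord (lift ord0 j) \o @Rd_cons d = coord j \o snd.
    by apply/funext => p /=; rewrite /coord /Rd_cons mxE liftK.
  by apply: measurableT_comp; [exact: measurable_coord|exact: measurable_snd].
have -> : coord ord0 \o @Rd_cons d = fst.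
  by apply/funext => p /=; rewrite /coord /Rd_cons mxE unlift_none.
exact: measurable_fst.
Qed.

Definition leb_step d (m : {measure set (Rd R d) -> \bar R}) :
    {measure set (Rd R d.+1) -> \bar R} :=
  measure_function_pushforward__canonical__measure_function_Measure
    (lebesgue_measure \x^ m)%E (@measurable_Rd_cons d).

(* Lebesgue measure on R^d, as the iterated product of one-dimensional ones. *)
Fixpoint leb d : {measure set (Rd R d) -> \bar R} :=
  if d is d'.+1 then leb_step (leb d') else dirac (0 : Rd R 0).

Lemma leb_box d (a b : Rd R d) : (forall i, coord i a <= coord i b) ->
  leb d [set x | forall i, coord i x \in `[coord i a, coord i b]] =
  (\prod_(i < d) (coord i b - coord i a))%:E.
Proof.
elim: d a b => [|d IH] a b ab.
  rewrite big_ord0 /= diracE mem_set//.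
  by case.
pose tl (x : Rd R d.+1) : Rd R d := \row_i coord (lift ord0 i) x.
have tlE i (x : Rd R d.+1) : coord i (tl x) = coord (lift ord0 i) x.
  by rewrite /tl /coord mxE.
pose box : set (Rd R d) :=
  [set x | forall i, coord i x \in `[coord i (tl a), coord i (tl b)]].
have mbox : measurable box.
  have -> : box = \bigcap_(i in [set: 'I_d])
      (coord i @^-1` `[coord i (tl a), coord i (tl b)]).
    by apply/seteqP; split=> [x bx i _|x bx i]; [exact: bx|exact: (bx i I)].
  apply: fin_bigcap_measurable; first exact: finite_finset.
  move=> i _; rewrite -[X in measurable X]setTI.
  by apply: measurable_coord => //; exact: measurable_itv.
rewrite /= /leb_step /= /pushforward.
have -> : @Rd_cons d @^-1`
    [set x | forall i, coord i x \in `[coord i a, coord i b]] =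
    `[coord ord0 a, coord ord0 b] `*` box.
  apply/seteqP; split=> [[x y] /= H|[x y] /= [H1 H2] i].
    split=> [|i]; first by have := H ord0; rewrite /coord mxE unlift_none.
    by have := H (lift ord0 i); rewrite !tlE {1}/coord mxE liftK.
  case: (unliftP ord0 i) => [j ->|->].
    by have := H2 j; rewrite !tlE /coord mxE liftK.
  by rewrite {1}/coord mxE unlift_none.
rewrite product_measure2E//.
rewrite /= IH; last by move=> i; rewrite !tlE.
rewrite lebesgue_measure_itv/= lte_fin big_ord_recl EFinM.
under eq_bigr do rewrite !tlE.
congr (_ * _)%E; case: ltP => // ba.
by have /eqP -> : coord ord0 b == coord ord0 a; rewrite ?subrr// eq_le ba ab.
Qed.

End lebesgue_Rd.

Section setting.
Context {R : realType} {d : nat}.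
Notation Rd := (Rd R d).
Notation Cd := 'rV[R[i]]_d.
Local Notation ldim := (@leb R d).
Local Notation mu1 := (@lebesgue_measure R).
Local Open Scope complex_scope.

(* The library norm on row vectors is the sup norm. *)
Definition enorm (x : Rd) : R := Num.sqrt (\sum_i coord i x ^+ 2).
Definition cnorm (z : Cd) : R :=
  Num.sqrt (\sum_j (complex.Re (z 0 j) ^+ 2 + complex.Im (z 0 j) ^+ 2)).

Definition measurable_Cd (g : Rd -> Cd) : Prop := forall j,
  measurable_fun [set: Rd] (fun x => complex.Re (g x 0 j)) /\
  measurable_fun [set: Rd] (fun x => complex.Im (g x 0 j)).

Definition cintegral d' (S : measurableType d')
    (m : {measure set S -> \bar R})
    (A : set S) (g : S -> Cd) : Cd :=
  \row_j ((\int[m]_(x in A) complex.Re (g x 0 j))%R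
        +i* (\int[m]_(x in A) complex.Im (g x 0 j))%R).

Definition unit_dir (xi : Rd) : Cd := \row_j (coord j xi / enorm xi)%:C.

(* Bilinear, without conjugation. *)
Definition dotC (a b : Cd) : R[i] := \sum_j a 0 j * b 0 j.

Definition proj_perp (xi : Rd) (a : Cd) : Cd :=
  a - dotC (unit_dir xi) a *: unit_dir xi.

Definition odot (xi : Rd) (a b : Cd) : Cd :=
  (- 'i / 2) *: (dotC (unit_dir xi) b *: proj_perp xi a
                 + dotC (unit_dir xi) a *: proj_perp xi b).

(* h is only meaningful off the origin, a null set of the integral. *)
Definition standard_majorizing_kernel (h : Rd -> R) : Prop :=
  [/\ measurable_fun [set xi : Rd | xi != 0] h,
      forall xi : Rd, xi != 0 -> 0 < h xi &
      forall xi : Rd, xi != 0 ->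
        (\int[ldim]_eta (h eta * h (xi - eta))%:E = (enorm xi * h xi)%:E)%E].

Definition Hker (h : Rd -> R) (eta xi : Rd) : R :=
  h eta * h (xi - eta) / (enorm xi * h xi).

(* A realization v |-> (W_v, T_v). Vertices are words: the root is [::], the
   children of v are rcons v false and rcons v true, v|j is take j v. *)
Definition tree := seq bool -> Rd * measurableTypeR R.

Definition tree_sigma : set_system tree :=
  <<s [set A | exists v (B : set (Rd * measurableTypeR R)),
         measurable B /\ A = [set w | B (w v)]] >>.

Definition subtree (v : seq bool) (w : tree) : tree := fun u => w (v ++ u).

Definition explosion (w : tree) : \bar R :=
  ereal_sup (range (fun n : nat =>
    \big[mine/+oo%E]_(v : n.-tuple bool)
      (\sum_(0 <= j < n.+1) (w (take j v)).2)%:E)).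

Inductive branching (V : Type) (op : Rd -> V -> V -> V) (c : Rd -> V)
    (w : tree) : seq bool -> R -> V -> Prop :=
| branching_leaf v s : s <= (w v).2 -> branching op c w v s (c (w v).1)
| branching_node v s a b : (w v).2 < s ->
    branching op c w (rcons v false) (s - (w v).2) a ->
    branching op c w (rcons v true) (s - (w v).2) b ->
    branching op c w v s (op (w v).1 a b).

(* The recursion started at the root, times the indicator of zeta > t. *)
Definition stopped (V : nmodType) (op : Rd -> V -> V -> V) (c : Rd -> V)
    (w : tree) (t : R) : V :=
  if (t%:E < explosion w)%E then xget 0 [set x | branching op c w [::] t x]
  else 0.

(* A family of probability spaces indexed by xi, each with variables W_v, T_v;
   nothing is assumed about its member at xi = 0. *)
Record cascade_family := CascadeFamily {
  cas_display : measure_display;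
  cas_Omega : Rd -> measurableType cas_display;
  cas_P : forall xi, probability (cas_Omega xi) R;
  cas_W : forall xi, seq bool -> {RV (cas_P xi) >-> Rd};
  cas_T : forall xi, seq bool -> {RV (cas_P xi) >-> R} }.

Definition cas_tree (K : cascade_family) (xi : Rd) (w : cas_Omega K xi) : tree :=
  fun v => (cas_W K xi v w, cas_T K xi v w).
Arguments cas_tree : clear implicits.

Definition cas_law (K : cascade_family) (xi : Rd) (A : set tree) : \bar R :=
  cas_P K xi [set w | A (cas_tree K xi w)].

Definition cas_event (K : cascade_family) (xi : Rd) (v : seq bool)
    (B : set Rd) (E : set (measurableTypeR R)) (C : set Rd) :
    set (cas_Omega K xi) :=
  [set w | [/\ B (cas_W K xi v w), E (cas_T K xi v w) &
               C (cas_W K xi (rcons v false) w)]].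
Arguments cas_event : clear implicits.

Record is_cascade (h : Rd -> R) (K : cascade_family) : Prop := IsCascade {
  (* the law is a kernel, so that it can be evaluated at W_v1 and W_v2; this
     already follows from the other clauses *)
  cas_kernel : forall A, tree_sigma A ->
    measurable_fun [set xi : Rd | xi != 0] (fun xi => cas_law K xi A);
  cas_root : forall (xi : Rd) w, xi != 0 -> cas_W K xi [::] w = xi;
  cas_children : forall (xi : Rd) v w, xi != 0 ->
    cas_W K xi (rcons v true) w = cas_W K xi v w - cas_W K xi (rcons v false) w;
  (* given W_v: T_v is exponential of rate |W_v|^2, W_v1 has density
     H(.|W_v), and they are independent *)
  cas_step : forall (xi : Rd) v (B C : set Rd) (E : set (measurableTypeR R)),
    xi != 0 -> measurable B -> measurable C -> measurable E ->
    cas_P K xi (cas_event K xi v B E C) =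
    (\int[cas_P K xi]_(w in [set w | B (cas_W K xi v w)])
      (exponential_prob (enorm (cas_W K xi v w) ^+ 2) E *
       \int[ldim]_(eta in C) (Hker h eta (cas_W K xi v w))%:E))%E;
  (* given T_v and W_v1, W_v2 (equivalently W_v, W_v1): the families on the two
     subtrees are independent cascades started at W_v1 and W_v2 *)
  cas_branch : forall (xi : Rd) v (B C : set Rd) (E : set (measurableTypeR R))
      (A1 A2 : set tree),
    xi != 0 -> measurable B -> measurable C -> measurable E ->
    tree_sigma A1 -> tree_sigma A2 ->
    cas_P K xi (cas_event K xi v B E C `&`
      [set w | A1 (subtree (rcons v false) (cas_tree K xi w)) /\
               A2 (subtree (rcons v true) (cas_tree K xi w))]) =
    (\int[cas_P K xi]_(w in cas_event K xi v B E C)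
      (cas_law K (cas_W K xi (rcons v false) w) A1 *
       cas_law K (cas_W K xi (rcons v true) w) A2))%E }.

Definition Yproc (psi0 : Rd -> \bar R) (w : tree) (t : R) : \bar R :=
  stopped (fun _ => mule) psi0 w t.

Definition Xproc (chi0 : Rd -> Cd) (w : tree) (t : R) : Cd :=
  stopped odot chi0 w t.

Section solutions.
Variables (h : Rd -> R) (K : cascade_family).

Definition minimal_nFMS (psi0 : Rd -> \bar R) (xi : Rd) (t : R) : \bar R :=
  (\int[cas_P K xi]_w Yproc psi0 (cas_tree K xi w) t)%E.

Definition minimal_nFNS (chi0 : Rd -> Cd) (xi : Rd) (t : R) : Cd :=
  cintegral (cas_P K xi) setT (fun w => Xproc chi0 (cas_tree K xi w) t).

Definition solves_nFNS_at (chi0 : Rd -> Cd) (chi : Rd -> R -> Cd)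
    (xi : Rd) (t : R) : Prop :=
  let k s := expR (- s * enorm xi ^+ 2) * enorm xi ^+ 2 in
  let I s eta := odot xi (chi eta (t - s)) (chi (xi - eta) (t - s)) in
  (\int[mu1]_(s in `[0%R, t]) \int[ldim]_eta
     (k s * (cnorm (I s eta) * Hker h eta xi))%:E < +oo)%E /\
  chi xi t = (expR (- t * enorm xi ^+ 2))%:C *: chi0 xi +
    cintegral mu1 `[0%R, t] (fun s => (k s)%:C *:
      cintegral ldim setT (fun eta => (Hker h eta xi)%:C *: I s eta)).

Definition has_minimal_nFNS_on (chi0 : Rd -> Cd) (S : set (Rd * R)) : Prop :=
  forall xi t, S (xi, t) ->
    (\int[cas_P K xi]_w (cnorm (Xproc chi0 (cas_tree K xi w) t))%:E < +oo)%E
    /\ solves_nFNS_at chi0 (minimal_nFNS chi0) xi t.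

End solutions.

End setting.
Arguments cascade_family : clear implicits.

Definition class_S (R : realType) (f : R -> R) : Prop :=
  [/\ forall x, 0 <= x -> 0 <= f x,
      forall a b, 0 <= a -> 0 <= b -> f (a * b) <= f a * f b,
      convex_function (`[0%R, +oo[ : set R^o) f,
      f 0 = 0 &
      exists2 x, 0 <= x & f x != 0].

Definition inv_S (R : realType) (f : R -> R) : R -> R :=
  'pinv_(fun=> 0) `[0%R, +oo[ f.

(* Main.v *)
Require Import Defs.
From mathcomp Require Import all_boot all_order all_algebra.
From mathcomp Require Import all_classical all_reals all_analysis.
From mathcomp Require Import measurable_realfun giry.
From mathcomp Require Import ring lra.
Import Order.TTheory GRing.Theory Num.Theory.
Import numFieldNormedType.Exports.
Local Open Scope classical_set_scope.
Local Open Scope ring_scope.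

(** Write X for the vector process, Y for the scalar process with leaves
    [f (|chi0| / 2)], and N = |X|. On a tree that has not exploded, X and Y are
    finite expressions over the same leaves. Splitting a and b along and across
    xi, the Cauchy-Schwarz inequality in the plane gives
    |odot xi a b| <= |a| |b| / 2 ([cnorm_odot]), so |X| / 2 is at most the
    product of the leaves |chi0| / 2; as [f] increases and is submultiplicative,
    f (|X| / 2) <= Y pathwise ([majorization]). Jensen's inequality then gives
    f (E|X| / 2) <= E Y = phi ([jensen_N]), where E|X| is finite because [f]
    grows at least linearly ([mean_N_lty]), and |chi| <= E|X| ([cnorm_chi_le]).

    The integral equations come from conditioning on the first step. Given T_0
    and W_1, the subtrees at the two children of the root are independent
    cascades. This is an identity between two laws on a product space, and it
    only has to be verified on boxes ([split_tree_law]); integrated, it turns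
    the mean of a product over the two subtrees into the mean of a product of
    means ([mean_branching]). The components of [odot] are real bilinear forms,
    so the equation for chi reduces to this identity for products of two signed
    functionals ([signed_branching], [chi_component]). Integrability of these
    products again comes from Y, through |X_1| |X_2| <= 4 (1 + Y_1 Y_2 / f 1)
    ([split_N_lty]). At some points eta of the integral, E|X| may be infinite;
    but a finite product of means can have an infinite factor only next to a
    zero one, and then both sides vanish ([fine_mulB]).

    The set D consists of the xi <> 0 with phi (xi, t) finite for every t < T.
    By Fubini's theorem, almost every xi has phi (xi, t) finite for almost every
    t < T. By the integral equation and the lack of memory of the exponential
    law, finiteness at one time implies finiteness at all earlier ones
    ([mean_product_lty_le], [mean_Y_lty_le]), so D has full measure
    ([finite_points_full]). *)

(* The coordinate of a point of R^d, not of a vector in a basis. *)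
Local Notation coord := Defs.coord.

(** * Submultiplicative convex functions *)

Section class_S_theory.
Context {R : realType} {f : R -> R}.
Hypothesis hf : class_S f.

Let f_ge0 x : 0 <= x -> 0 <= f x.
Proof. by have [f_ge0 _ _ _ _] := hf; exact: f_ge0. Qed.

Let f0 : f 0 = 0. Proof. by case: hf. Qed.

(** Convexity at the three points [x <= y <= z], free of divisions. *)
Lemma class_S_chord x y z : 0 <= x -> x <= y -> y <= z -> x < z ->
  (z - x) * f y <= (z - y) * f x + (y - x) * f z.
Proof.
move=> x0 xy yz xz; have zx0 : 0 < z - x by rewrite subr_gt0.
pose t := (z - y) / (z - x).
have t0 : 0 <= t by rewrite divr_ge0 ?(ltW zx0)// subr_ge0.
have t1 : t <= 1 by rewrite ler_pdivrMr// mul1r lerB.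
have [_ _ cvx _ _] := hf.
have := cvx (Itv01 t0 t1) x z; rewrite !inE/= !in_itv/= !andbT.
move=> /(_ x0 (le_trans x0 (ltW xz))).
have -> : conv (Itv01 t0 t1) (x : convex_lmodType R^o) (z : convex_lmodType R^o)
    = y.
  transitivity (t * x + (1 - t) * z) => //.
  by rewrite /t; field; rewrite gt_eqF.
have -> : conv (Itv01 t0 t1) (f x : R^o) (f z : R^o) = t * f x + (1 - t) * f z.
  by [].
rewrite -(ler_pM2l zx0) => /le_trans; apply.
by rewrite le_eqVlt /t; apply/orP; left; apply/eqP; field; rewrite gt_eqF.
Qed.

(** A zero at [x > 0] would spread to every [y], as [f y <= f (y / x) * f x]. *)
Lemma class_S_gt0 x : 0 < x -> 0 < f x.
Proof.
move=> x0; rewrite lt_neqAle f_ge0 1?ltW// andbT eq_sym; apply/negP => /eqP fx0.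
have [_ sub _ _ [y y0 /negP]] := hf; apply; rewrite eq_le f_ge0// andbT.
have := sub (y / x) x (divr_ge0 y0 (ltW x0)) (ltW x0).
by rewrite fx0 mulr0 divfK ?gt_eqF.
Qed.

Lemma class_S_lt x y : 0 <= x -> x < y -> f x < f y.
Proof.
move=> x0 xy; have y0 := le_lt_trans x0 xy.
have := class_S_chord 0 x y (lexx _) x0 (ltW xy) y0.
rewrite f0 mulr0 add0r !subr0 => H; rewrite -(ltr_pM2l y0).
by apply: le_lt_trans H _; rewrite ltr_pM2r// class_S_gt0.
Qed.

Lemma class_S_le x y : 0 <= x -> x <= y -> f x <= f y.
Proof.
by move=> x0; rewrite le_eqVlt => /predU1P[->//|/class_S_lt xy]; exact/ltW/xy.
Qed.

(** Past 1 the graph lies above the chord through the origin. *)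
Lemma class_S_linear_bound x : 0 <= x -> x <= 1 + f x / f 1.
Proof.
move=> x0; have f1 : 0 < f 1 by apply: class_S_gt0.
have [x1|x1] := leP x 1; first by rewrite (le_trans x1)// lerDl divr_ge0 ?f_ge0.
have := class_S_chord 0 1 x (lexx _) ler01 (ltW x1) (lt_trans ltr01 x1).
rewrite f0 mulr0 add0r !subr0 mul1r -ler_pdivlMr// => /le_trans; apply.
by rewrite lerDr.
Qed.

(* The slope over [a, b] is at most the slope over [a, M + 1], which is at most
   f (M + 1) because that interval has length at least 1. *)
Let f_lipschitz M a b : 0 <= a -> a <= b -> b <= M ->
  f b - f a <= (b - a) * f (M + 1).
Proof.
move=> a0 ab bM.
have fab : 0 <= f b - f a by rewrite subr_ge0 class_S_le.
have bM1 : b <= M + 1 by lra.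
have aM1 : a < M + 1 by lra.
have := class_S_chord a b (M + 1) a0 ab bM1 aM1.
have fa := f_ge0 _ a0.
move: (f (M + 1)) (f a) (f b) fab fa => u v w fab fa H.
have : 0 <= (M - a) * (w - v) by apply: mulr_ge0 => //; lra.
have : 0 <= (b - a) * v by apply: mulr_ge0 => //; lra.
nra.
Qed.

(** The preimage of [y] is the supremum of the sublevel set, which is bounded by
    the linear bound; [f] cannot jump there since it is locally Lipschitz. *)
Lemma class_S_surj y : 0 <= y -> exists2 x, 0 <= x & f x = y.
Proof.
move=> y0; have f1 : 0 < f 1 by apply: class_S_gt0.
pose S := [set x | 0 <= x /\ f x <= y].
have S0 : S 0 by split; rewrite ?f0.
pose M := 1 + y / f 1.
have ubS : ubound S M.
  move=> x [x0 fxy]; apply: (le_trans (class_S_linear_bound _ x0)).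
  by rewrite lerD2l ler_pM2r ?invr_gt0.
have hS : has_sup S by split; [exists 0|exists M].
pose s := sup S.
have s0 : 0 <= s by apply: ub_le_sup; [exists M|].
have sM : s <= M by apply: ge_sup; [exists 0|].
have M2 : M + 1 + 1 = M + 2 by ring.
have L0 : 0 < f (M + 2) by apply: class_S_gt0; lra.
exists s => //; apply/eqP; rewrite eq_le; apply/andP; split; rewrite leNgt;
  apply/negP => lt.
- pose e := (f s - y) / f (M + 2).
  have e0 : 0 < e by rewrite divr_gt0// subr_gt0.
  have [x [x0 fxy] sx] := sup_adherent e0 hS.
  have xs : x <= s by apply: ub_le_sup; [exists M|].
  have := f_lipschitz (M + 1) x s x0 xs ltac:(lra).
  rewrite M2.
  have : (s - x) * f (M + 2) < e * f (M + 2) by rewrite ltr_pM2r//;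
    rewrite -/s in sx; lra.
  by rewrite /e divfK ?gt_eqF//; lra.
- pose e := Num.min 1 ((y - f s) / f (M + 2)).
  have e0 : 0 < e by rewrite lt_min ltr01 divr_gt0// subr_gt0.
  have e1 : e <= 1 by rewrite ge_min lexx.
  have := f_lipschitz (M + 1) s (s + e) s0 ltac:(lra) ltac:(lra).
  rewrite M2 => Hl.
  have He : (s + e - s) * f (M + 2) <= y - f s.
    by rewrite addrAC subrr add0r -ler_pdivlMr// ge_min lexx orbT.
  have : S (s + e) by split; lra.
  by move=> /(ub_le_sup (ex_intro _ M ubS)); rewrite -/s; lra.
Qed.

Lemma inv_S_spec y : 0 <= y -> 0 <= inv_S f y /\ f (inv_S f y) = y.
Proof.
move=> y0.
have surj : set_surj `[0%R, +oo[ `[0%R, +oo[ f.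
  move=> z/=; rewrite in_itv/= andbT => z0.
  by have [x x0 fx] := class_S_surj _ z0; exists x; rewrite //= in_itv/= x0.
have yin : y \in `[0%R, +oo[%classic by rewrite inE/= in_itv/= y0.
split; last by rewrite /inv_S (surjpK _ surj).
suff : `[0, +oo[%classic (inv_S f y) by rewrite /= in_itv/= andbT.
apply: (surjpinv_image_sub surj).
by exists y => //; rewrite inE in yin.
Qed.

Lemma le_inv_S x y : 0 <= x -> f x <= y -> x <= inv_S f y.
Proof.
move=> x0 fxy; have y0 := le_trans (f_ge0 _ x0) fxy.
have [i0 fi] := inv_S_spec _ y0.
by rewrite leNgt; apply/negP => /(class_S_lt _ _ i0); rewrite fi ltNge fxy.
Qed.

(** The slope is the supremum of the slopes of the chords that end at [z0]. *)
Lemma class_S_support z0 : 0 < z0 ->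
  exists2 m, 0 <= m & forall z, 0 <= z -> f z0 + m * (z - z0) <= f z.
Proof.
move=> z00.
pose S := [set (f z0 - f z) / (z0 - z) | z in [set z | 0 <= z < z0]].
have ubS w : z0 < w -> ubound S ((f w - f z0) / (w - z0)).
  move=> zw _ [z /andP[z0' zz0] <-].
  have := class_S_chord z z0 w z0' (ltW zz0) (ltW zw) (lt_trans zz0 zw).
  rewrite ler_pdivrMr ?subr_gt0// mulrAC ler_pdivlMr ?subr_gt0//.
  by move: (f z0) (f w) (f z) => *; nra.
have hS : has_ubound S by exists ((f (z0 + 1) - f z0) / (z0 + 1 - z0));
  apply: ubS; lra.
have S0 : S ((f z0 - f 0) / (z0 - 0)) by exists 0 => //=; rewrite lexx.
exists (sup S).
  apply: le_trans (ub_le_sup hS S0); rewrite f0 !subr0 divr_ge0 ?f_ge0// ltW//.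
move=> z zge0; have [zz|zz|->] := ltgtP z z0; last by rewrite subrr mulr0 addr0.
- have : (f z0 - f z) / (z0 - z) <= sup S.
    by apply: ub_le_sup => //; exists z => //=; rewrite zge0.
  by rewrite ler_pdivrMr ?subr_gt0//; lra.
- have : sup S <= (f z - f z0) / (z - z0).
    by apply: ge_sup; [eexists; exact: S0|exact: ubS].
  by rewrite ler_pdivlMr ?subr_gt0//; lra.
Qed.

Lemma measurable_class_S d (T : measurableType d) (g : T -> R) :
  measurable_fun setT g -> (forall x, 0 <= g x) ->
  measurable_fun setT (f \o g).
Proof.
move=> mg g0.
have -> : f \o g = (f \o Num.max 0) \o g.
  by apply/funext => x /=; rewrite max_r.
apply: measurableT_comp => //; apply: nondecreasing_measurable => // x y xy /=.
apply: class_S_le; first by rewrite le_max lexx.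
by rewrite ge_max !le_max lexx xy orbT.
Qed.

End class_S_theory.

(** * Complex vectors and the product [odot] *)

Section euclidean_sums.
Context {R : realType} {I : finType}.
Implicit Types x y : I -> R.

Lemma sum_sqr_ge0 x : 0 <= \sum_i x i ^+ 2.
Proof. by apply: sumr_ge0 => i _; exact: sqr_ge0. Qed.

Lemma cauchy_schwarz_sum x y :
  \sum_i x i * y i <= Num.sqrt (\sum_i x i ^+ 2) * Num.sqrt (\sum_i y i ^+ 2).
Proof.
set X := \sum_i x i ^+ 2; set Y := \sum_i y i ^+ 2; set S := \sum_i _.
rewrite -sqrtrM ?sum_sqr_ge0//.
have [Y0|Y0] := eqVneq Y 0.
  rewrite Y0 mulr0 sqrtr0 /S big1// => i _.
  have /eqP : y i ^+ 2 = 0 by apply: (psumr_eq0P _ Y0) => // j _;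
    exact: sqr_ge0.
  by rewrite sqrf_eq0 => /eqP ->; rewrite mulr0.
have Ypos : 0 < Y by rewrite lt_neqAle eq_sym Y0 sum_sqr_ge0.
have : 0 <= \sum_i (Y * x i - S * y i) ^+ 2 by exact: sum_sqr_ge0.
rewrite (eq_bigr (fun i => Y ^+ 2 * x i ^+ 2 +
    ((- (2 * Y * S)) * (x i * y i) + S ^+ 2 * y i ^+ 2))); last first.
  by move=> i _; ring.
rewrite !big_split/= -!mulr_sumr -/X -/Y -/S => H.
have {H} : S ^+ 2 <= X * Y.
  by rewrite -(ler_pM2l Ypos) -subr_ge0; apply: le_trans H _; rewrite le_eqVlt;
    apply/orP; left; apply/eqP; ring.
have [S0|S0] := leP 0 S => [SXY|_].
  by rewrite -(ger0_norm S0) -sqrtr_sqr ler_sqrt// (le_trans (sqr_ge0 S)).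
by rewrite (le_trans (ltW S0))// sqrtr_ge0.
Qed.

Lemma minkowski_sum x y : Num.sqrt (\sum_i (x i + y i) ^+ 2) <=
  Num.sqrt (\sum_i x i ^+ 2) + Num.sqrt (\sum_i y i ^+ 2).
Proof.
have CS := cauchy_schwarz_sum x y.
have [X0 Y0] := (sum_sqr_ge0 x, sum_sqr_ge0 y).
rewrite -[leRHS]ger0_norm ?addr_ge0 ?sqrtr_ge0// -sqrtr_sqr ler_sqrt ?sqr_ge0//.
rewrite sqrrD !sqr_sqrtr// (eq_bigr (fun i => x i ^+ 2 + (2 * (x i * y i)
  + y i ^+ 2))).
  by rewrite !big_split/= -mulr_sumr; lra.
by move=> i _; ring.
Qed.

(** Pythagoras, for the projection along the unit vector [e]. *)
Lemma sum_sqr_proj (e x : I -> R) : \sum_i e i ^+ 2 = 1 ->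
  \sum_i (x i - (\sum_j e j * x j) * e i) ^+ 2 + (\sum_j e j * x j) ^+ 2 =
  \sum_i x i ^+ 2.
Proof.
move=> e1; set a := \sum_j e j * x j.
rewrite (eq_bigr (fun i => x i ^+ 2 + ((- (2 * a)) * (e i * x i)
  + a ^+ 2 * e i ^+ 2))).
  by rewrite !big_split/= -!mulr_sumr e1 -/a; ring.
by move=> i _; ring.
Qed.

End euclidean_sums.

Section complex_vectors.
Context {R : realType} {d : nat}.
Notation Cd := 'rV[complex R]_d.
Notation idx := (bool * 'I_d)%type.
Local Open Scope complex_scope.
Implicit Types (a b z : Cd) (p q : idx).

(** C^d as a real vector space of dimension 2d: [(false, j)] indexes real parts,
    [(true, j)] imaginary parts. *)
Definition rcoord p z : R :=
  if p.1 then complex.Im (z 0 p.2) else complex.Re (z 0 p.2).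

Definition cbasis p : Cd := (if p.1 then 'i else 1) *: delta_mx 0 p.2.

Lemma sum_idx (F : idx -> R) :
  \sum_p F p = \sum_j (F (false, j) + F (true, j)).
Proof.
rewrite (eq_bigr (fun p => F (p.1, p.2))) => [|[]//].
rewrite -(pair_bigA _ (fun i j => F (i, j)))/= big_bool/= big_split/=.
by rewrite addrC.
Qed.

Lemma cnormE z : cnorm z = Num.sqrt (\sum_p rcoord p z ^+ 2).
Proof. by rewrite sum_idx. Qed.

Lemma cnorm_ge0 z : 0 <= cnorm z. Proof. exact: sqrtr_ge0. Qed.

Lemma rcoord_le_cnorm p z : `|rcoord p z| <= cnorm z.
Proof.
rewrite cnormE -sqrtr_sqr ler_sqrt ?sum_sqr_ge0//.
by rewrite (bigD1 p)//= lerDl sumr_ge0// => i _; exact: sqr_ge0.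
Qed.

Lemma cnorm0 : cnorm (0 : Cd) = 0.
Proof.
by rewrite /cnorm big1 ?sqrtr0// => j _; rewrite !mxE/= expr0n addr0.
Qed.

Lemma rcoord0 p : rcoord p 0 = 0.
Proof. by rewrite /rcoord mxE; case: p.1. Qed.

Lemma rcoordD p a b : rcoord p (a + b) = rcoord p a + rcoord p b.
Proof. by rewrite /rcoord mxE; case: p.1;
  case: (a 0 _) (b 0 _) => ? ? [? ?]. Qed.

Lemma rcoord_sum p (I : finType) (F : I -> Cd) :
  rcoord p (\sum_i F i) = \sum_i rcoord p (F i).
Proof. by apply: (big_morph (rcoord p)); [exact: rcoordD|exact: rcoord0]. Qed.

Lemma rcoordZ p (r : R) a : rcoord p (r%:C *: a) = r * rcoord p a.
Proof.
by rewrite /rcoord mxE; case: p.1; case: (a 0 _) => x y /=;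
  rewrite mul0r ?subr0 ?addr0.
Qed.

Lemma rcoord_inj a b : (forall p, rcoord p a = rcoord p b) -> a = b.
Proof.
move=> ab; apply/rowP => j; apply/eqP; rewrite eq_complex.
by rewrite (ab (false, j) : complex.Re _ = _) (ab (true, j) : complex.Im _ = _)
  !eqxx.
Qed.

Lemma rcoord_cbasis p q : rcoord p (cbasis q) = (p == q)%:R.
Proof.
case: p q => pb j [qb k]; rewrite /rcoord /cbasis !mxE xpair_eqE/=.
case: (eqVneq j k) => [_|_]; rewrite ?andbF ?andbT; case: pb qb => -[] /=;
  by rewrite ?(mulr1, mulr0, mul0r, subr0, addr0, add0r, oppr0).
Qed.

Lemma cbasis_decomp z : z = \sum_p (rcoord p z)%:C *: cbasis p.
Proof.
apply: rcoord_inj => p; rewrite rcoord_sum (bigD1 p)//= big1 => [|q qp].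
  by rewrite rcoordZ rcoord_cbasis eqxx mulr1 addr0.
by rewrite rcoordZ rcoord_cbasis eq_sym (negbTE qp) mulr0.
Qed.

Lemma dotCP a (c : complex R) u v :
  dotC a (c *: u + v) = c * dotC a u + dotC a v.
Proof.
rewrite /dotC mulr_sumr -big_split/=; apply: eq_bigr => j _.
by rewrite !mxE mulrDr mulrCA.
Qed.

Lemma proj_perp_linear (xi : Rd R d) : linear (proj_perp xi).
Proof.
move=> c u v; rewrite /proj_perp dotCP scalerDl scalerBr -scalerA opprD.
by rewrite addrACA.
Qed.

Lemma odotC (xi : Rd R d) a b : odot xi a b = odot xi b a.
Proof. by rewrite /odot addrC. Qed.

Lemma odot_linear (xi : Rd R d) a : linear (odot xi a).
Proof.
move=> c u v; rewrite /odot dotCP proj_perp_linear.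
move: (dotC _ u) (dotC _ v) (dotC _ a) => du dv da.
move: (proj_perp _ u) (proj_perp _ v) (proj_perp _ a) => pu pv pa.
by apply/rowP => j; rewrite !mxE; ring.
Qed.

Lemma odot_sumr (xi : Rd R d) a (I : finType) (c : I -> R) (F : I -> Cd) :
  odot xi a (\sum_i (c i)%:C *: F i) = \sum_i (c i)%:C *: odot xi a (F i).
Proof.
have odotD u v : odot xi a (u + v) = odot xi a u + odot xi a v.
  by rewrite -{1}[u]scale1r odot_linear scale1r.
have odot0 : odot xi a 0 = 0.
  by apply: (addrI (odot xi a 0)); rewrite -odotD !addr0.
elim/big_ind2: _ => [//|u1 u2 v1 v2 <- <-|i _]; first exact: odotD.
by rewrite -[X in odot _ _ X]addr0 odot_linear odot0 addr0.
Qed.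

(** The matrix of the real bilinear map [odot xi]. *)
Definition odot_coef (xi : Rd R d) p q r : R :=
  rcoord p (odot xi (cbasis q) (cbasis r)).

Lemma rcoord_odot (xi : Rd R d) p a b : rcoord p (odot xi a b) =
  \sum_q \sum_r odot_coef xi p q r * (rcoord q a * rcoord r b).
Proof.
rewrite {1}(cbasis_decomp a) odotC odot_sumr rcoord_sum; apply: eq_bigr => q _.
rewrite rcoordZ odotC {1}(cbasis_decomp b) odot_sumr rcoord_sum mulr_sumr.
by apply: eq_bigr => r _; rewrite rcoordZ /odot_coef; ring.
Qed.

Lemma odot0l (xi : Rd R d) a : odot xi 0 a = 0.
Proof.
apply: rcoord_inj => p; rewrite rcoord_odot rcoord0 big1// => q _.
by rewrite big1// => r _; rewrite rcoord0 mul0r mulr0.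
Qed.

Lemma odot0r (xi : Rd R d) a : odot xi a 0 = 0.
Proof. by rewrite odotC odot0l. Qed.

Let nsq (c : complex R) : R := complex.Re c ^+ 2 + complex.Im c ^+ 2.

Lemma cnormZ (c : complex R) z : cnorm (c *: z) = Num.sqrt (nsq c) * cnorm z.
Proof.
rewrite /cnorm -sqrtrM ?addr_ge0 ?sqr_ge0//; congr Num.sqrt.
rewrite mulr_sumr; apply: eq_bigr => j _; rewrite mxE /nsq.
by case: c (z 0 j) => x y [u v] /=; ring.
Qed.

Lemma cnormD a b : cnorm (a + b) <= cnorm a + cnorm b.
Proof.
rewrite !cnormE; under eq_bigr do rewrite rcoordD; exact: minkowski_sum.
Qed.

Lemma coord0 (i : 'I_d) : coord i (0 : Rd R d) = 0.
Proof. exact: mxE. Qed.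

Lemma unit_dir0 : unit_dir (0 : Rd R d) = 0.
Proof. by apply/rowP => j; rewrite !mxE coord0 mul0r. Qed.

Lemma enorm_sqr (xi : Rd R d) : enorm xi ^+ 2 = \sum_i coord i xi ^+ 2.
Proof. by rewrite sqr_sqrtr// sum_sqr_ge0. Qed.

Lemma enorm_gt0 (xi : Rd R d) : xi != 0 -> 0 < enorm xi.
Proof.
move=> xi0; rewrite lt_neqAle sqrtr_ge0 andbT eq_sym -sqrf_eq0 enorm_sqr.
apply: contra xi0 => /eqP H; apply/eqP/rowP => i.
have /eqP : coord i xi ^+ 2 = 0.
  by apply: (psumr_eq0P _ H) => // j _; exact: sqr_ge0.
by rewrite sqrf_eq0 => /eqP xii; rewrite mxE; exact: xii.
Qed.

Lemma cnorm_proj_perp (xi : Rd R d) a : xi != 0 ->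
  nsq (dotC (unit_dir xi) a) + cnorm (proj_perp xi a) ^+ 2 = cnorm a ^+ 2.
Proof.
move=> xi0; pose e j := coord j xi / enorm xi.
have e1 : \sum_j e j ^+ 2 = 1.
  under eq_bigr do rewrite exprMn; rewrite -mulr_suml -enorm_sqr -exprMn.
  by rewrite divff ?expr1n// gt_eqF// enorm_gt0.
have dot : dotC (unit_dir xi) a = (\sum_j e j * complex.Re (a 0 j)) +i*
    (\sum_j e j * complex.Im (a 0 j)).
  rewrite /dotC.
  pose F j := (e j * complex.Re (a 0 j)) +i* (e j * complex.Im (a 0 j)).
  rewrite (eq_bigr F) => [|j _]; last first.
    rewrite /F mxE -/(e j); case: (a 0 j) => x y; apply/eqP.
    by rewrite eq_complex/= !mul0r subr0 addr0 !eqxx.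
  by elim/big_ind3: _ => // x1 u1 v1 x2 u2 v2 -> ->.
rewrite !sqr_sqrtr; [|by apply: sumr_ge0 => j _; rewrite addr_ge0 ?sqr_ge0..].
rewrite /proj_perp dot /nsq/= [RHS]big_split/=.
rewrite -(sum_sqr_proj e (fun j => complex.Re (a 0 j)) e1).
rewrite -(sum_sqr_proj e (fun j => complex.Im (a 0 j)) e1).
set u := \sum_j e j * complex.Re _; set v := \sum_j e j * complex.Im _.
rewrite (eq_bigr (fun j => (complex.Re (a 0 j) - u * e j) ^+ 2 +
  (complex.Im (a 0 j) - v * e j) ^+ 2)) => [|j _].
  by rewrite big_split/=; ring.
by rewrite !mxE -/(e j); case: (a 0 j) => x y /=; rewrite !mulr0 subr0 add0r.
Qed.

(** The constant 1/2 is Cauchy-Schwarz in the plane, for the splittings of [a]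
    and [b] along and across [xi]. *)
Lemma cnorm_odot (xi : Rd R d) a b : cnorm (odot xi a b)
  <= cnorm a * cnorm b / 2.
Proof.
have [->|xi0] := eqVneq xi 0.
  have dot0 z : dotC (0 : Cd) z = 0.
    by rewrite /dotC big1// => j _; rewrite mxE mul0r.
  have -> : odot 0 a b = 0.
    by rewrite /odot unit_dir0 !dot0 !scale0r addr0 scaler0.
  by rewrite cnorm0 divr_ge0// mulr_ge0// cnorm_ge0.
have Ha := cnorm_proj_perp xi a xi0; have Hb := cnorm_proj_perp xi b xi0.
rewrite /odot cnormZ.
have half : - 'i / 2 = 0 +i* (- 2^-1) :> complex R.
  apply: (mulIf (_ : (2 : complex R) != 0)); first by rewrite pnatr_eq0.
  rewrite divfK ?pnatr_eq0//; apply/eqP; rewrite eq_complex/=.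
  by apply/andP; split; apply/eqP; field.
have -> : Num.sqrt (nsq (- 'i / 2)) = 2^-1.
  by rewrite half /nsq/= expr0n add0r sqrrN sqrtr_sqr ger0_norm.
rewrite mulrC ler_pM2r; last by rewrite invr_gt0.
apply: le_trans (cnormD _ _) _; rewrite !cnormZ.
have sq (c : complex R) : nsq c = Num.sqrt (nsq c) ^+ 2.
  by rewrite sqr_sqrtr// addr_ge0 ?sqr_ge0.
rewrite sq in Ha; rewrite sq in Hb.
move: (cnorm_ge0 a) (cnorm_ge0 b) Ha Hb.
move: (Num.sqrt (nsq (dotC _ a))) (Num.sqrt (nsq (dotC _ b))) => x y.
move: (cnorm (proj_perp _ a)) (cnorm (proj_perp _ b)) => u v.
move: (cnorm a) (cnorm b) => A B A0 B0 HA HB.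
apply: (@le_trans _ _ (Num.sqrt ((A * B) ^+ 2)));
  last by rewrite sqrtr_sqr ger0_norm// mulr_ge0.
apply: (@le_trans _ _ `|y * u + x * v|); first exact: ler_norm.
rewrite -sqrtr_sqr ler_sqrt ?sqr_ge0// exprMn -HA -HB.
by have := sqr_ge0 (x * y - u * v); lra.
Qed.

End complex_vectors.

(** * The recursion on a fixed tree *)

Section pathwise.
Context {R : realType} {d : nat}.
Notation tree := (@Defs.tree R d).
Implicit Types (w : tree) (s t : R) (n : nat).

Definition left_subtree w : tree := subtree [:: false] w.
Definition right_subtree w : tree := subtree [:: true] w.

(** The condition that the minimum over generation [n] in the definition of the
    explosion time exceeds [s], by recursion on the depth so that it unfolds
    together with the processes. *)
Fixpoint alive n w s : bool :=
  if n is n'.+1 then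
    alive n' (left_subtree w) (s - (w [::]).2) &&
    alive n' (right_subtree w) (s - (w [::]).2)
  else s < (w [::]).2.

Lemma aliveP n w s : reflect (forall v : seq bool, size v = n ->
    s < \sum_(0 <= j < n.+1) (w (take j v)).2) (alive n w s).
Proof.
elim: n w s => [|n IH] w s.
  apply: (iffP idP) => [ws [|//] _|/(_ [::] erefl)]; rewrite big_nat1//.
apply: (iffP andP) => [[/IH sl /IH sr] [//|b v] [sv]|H].
  rewrite big_nat_recl//= addrC -ltrBlDr.
  by case: b; [exact: sr|exact: sl].
by split; apply/IH => v sv; rewrite ltrBlDr addrC;
  [have := H (false :: v)|have := H (true :: v)];
  rewrite /= sv big_nat_recl//=; apply.
Qed.

Lemma lt_explosion w s : (s%:E < explosion w)%E <-> exists n, alive n w s.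
Proof.
split=> [/ereal_sup_gt [_ [n _ <-] sn]|[n /aliveP sn]].
  exists n; apply/aliveP => v /eqP sv.
  rewrite -lte_fin; apply: (lt_le_trans sn).
  by rewrite (bigD1 (Tuple sv))//= ge_min lexx.
suff H : (s%:E < \big[mine/+oo%E]_(v : n.-tuple bool)
    (\sum_(0 <= j < n.+1) (w (take j v)).2)%:E)%E.
  by apply: (lt_le_trans H); apply: ereal_sup_ubound; exists n.
elim/big_ind: _ => [|x y sx sy|v _]; first by rewrite ltry.
  by rewrite lt_min sx.
by rewrite lte_fin; apply: sn; rewrite size_tuple.
Qed.

Definition positive_times w := forall v, 0 < (w v).2.

Lemma positive_left w : positive_times w -> positive_times (left_subtree w).
Proof. by move=> pw v; exact: pw. Qed.

Lemma positive_right w : positive_times w -> positive_times (right_subtree w).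
Proof. by move=> pw v; exact: pw. Qed.

(** Positive times make the partial sums increase along a branch. *)
Lemma alive_le n m w s : positive_times w -> (n <= m)%N -> alive n w s ->
  alive m w s.
Proof.
move=> + /subnK <-; elim: (m - n)%N w s => [//|k IH] w s pw.
move=> /(IH _ _ pw); rewrite addSn;
  elim: (k + n)%N w s pw {IH} => [|j IH] w s pw.
  move=> /= sw; have pl := pw [:: false]; have pr := pw [:: true].
  by apply/andP; split; rewrite ltrBlDl; [apply: (lt_trans sw);
    rewrite ltrDl..].
by move=> /andP[sl sr]; apply/andP; split; apply: IH => //;
  [exact: positive_left|exact: positive_right].
Qed.

Section evaluation.
Context {V : nmodType}.
Variables (op : Rd R d -> V -> V -> V) (c : Rd R d -> V).

(** The recursion cut at depth [n], with 0 below the cut, which is not reached on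
    the trees that are alive at [n]. *)
Fixpoint evaluate n w s : V :=
  if s <= (w [::]).2 then c (w [::]).1
  else if n is n'.+1 then
    op (w [::]).1 (evaluate n' (left_subtree w) (s - (w [::]).2))
                  (evaluate n' (right_subtree w) (s - (w [::]).2))
  else 0.

Lemma branching_subtree w u v s x :
  branching op c (subtree u w) v s x -> branching op c w (u ++ v) s x.
Proof.
elim=> {v s x} [v s vs|v s a b vs _ IHa _ IHb]; first exact: branching_leaf.
by apply: branching_node => //; rewrite rcons_cat.
Qed.

Lemma branching_evaluate n w s : alive n w s ->
  branching op c w [::] s (evaluate n w s).
Proof.
elim: n w s => [|n IH] w s /=; first by move=> /ltW sw; rewrite sw;
  exact: branching_leaf.
move=> /andP[/IH sl /IH sr]; case: leP => sw; first exact: branching_leaf.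
by apply: branching_node => //=;
  [exact: (branching_subtree w [:: false] _ _ _ sl)|
  exact: (branching_subtree w [:: true] _ _ _ sr)].
Qed.

Lemma branching_fun w v s x y :
  branching op c w v s x -> branching op c w v s y -> x = y.
Proof.
move=> H; elim: H y => {v s x} [v s vs|v s a b vs _ IHa _ IHb] y H.
  case: _ _ y / H vs => // {}v {}s a b vs _ _; by rewrite leNgt vs.
case: _ _ y / H vs IHa IHb => [{}v {}s vs|{}v {}s a' b' _ Ha Hb _ IHa IHb].
  by rewrite ltNge vs.
by rewrite (IHa _ Ha) (IHb _ Hb).
Qed.

Lemma stopped_alive n w s : alive n w s ->
  stopped op c w s = evaluate n w s.
Proof.
move=> sw; rewrite /stopped ifT; last by apply/lt_explosion; exists n.
have Hn := branching_evaluate n w s sw.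
by case: xgetP => [x _ /(branching_fun _ _ _ _ _ Hn)//|/(_ (evaluate n w s))].
Qed.

Lemma stopped_dead w s : (forall n, ~~ alive n w s) -> stopped op c w s = 0.
Proof.
move=> dead; rewrite /stopped ifF//; apply/negP => /lt_explosion[n].
exact/negP.
Qed.

(** With [s] equal to the first time, survival beyond [s] uses the times of the
    children. *)
Lemma stopped_leaf w s : positive_times w -> s <= (w [::]).2 ->
  stopped op c w s = c (w [::]).1.
Proof.
move=> pw sw; rewrite (stopped_alive 1); first by rewrite /= sw.
have pl := pw [:: false]; have pr := pw [:: true].
by apply/andP; split; rewrite /= ltrBlDl; apply: (le_lt_trans sw);
  rewrite ltrDl.
Qed.

(** A node whose left or right part has exploded is 0 because 0 absorbs. *)
Lemma stopped_node w s : (forall xi a, op xi 0 a = 0) ->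
  (forall xi a, op xi a 0 = 0) -> positive_times w -> (w [::]).2 < s ->
  stopped op c w s = op (w [::]).1
    (stopped op c (left_subtree w) (s - (w [::]).2))
    (stopped op c (right_subtree w) (s - (w [::]).2)).
Proof.
move=> op0l op0r pw ws; set s' := s - _.
have pl := positive_left w pw; have pr := positive_right w pw.
have [[n nl]|dead] := pselect (exists n, alive n (left_subtree w) s');
  last first.
  rewrite (stopped_dead (left_subtree w)) => [|n]; last first.
    by apply/negP => nl; apply: dead; exists n.
  rewrite op0l stopped_dead// => n;
    apply/negP => /(alive_le _ n.+1 _ _ pw (leqnSn n)).
  by move=> /andP[nl _]; apply: dead; exists n.
have [[m mr]|dead] := pselect (exists n, alive n (right_subtree w) s');
  last first.
  rewrite (stopped_dead (right_subtree w)) => [|k]; last first.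
    by apply/negP => kr; apply: dead; exists k.
  rewrite op0r stopped_dead// => k;
    apply/negP => /(alive_le _ k.+1 _ _ pw (leqnSn k)).
  by move=> /andP[_ kr]; apply: dead; exists k.
have {}nl := alive_le _ _ _ _ pl (leq_maxl n m) nl.
have {}mr := alive_le _ _ _ _ pr (leq_maxr n m) mr.
rewrite (stopped_alive _ _ _ nl) (stopped_alive _ _ _ mr).
rewrite (stopped_alive (maxn n m).+1) /=; first by rewrite leNgt ws.
by rewrite nl mr.
Qed.

End evaluation.
End pathwise.

(** * Measurability on the space of trees *)

Section measurable_trees.
Context {R : realType} {d : nat}.
Notation tree := (@Defs.tree R d).
Notation node := (Rd R d * measurableTypeR R)%type.

Definition tree_cylinders : set_system tree :=
  [set A | exists v (B : set node), measurable B /\ A = [set w | B (w v)]].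

(** Trees as a measurable space, with the sigma-algebra [tree_sigma]. *)
Definition mtree := g_sigma_algebraType tree_cylinders.

Lemma measurable_node v : measurable_fun [set: mtree] (fun w : mtree =>
  w v : node).
Proof.
by move=> _ B mB; rewrite setTI; apply: sub_sigma_algebra; exists v, B.
Qed.

Lemma measurable_fun_treeP d' (S : measurableType d') (g : S -> mtree) :
  (forall v, measurable_fun [set: S] (fun s => g s v : node)) ->
  measurable_fun [set: S] g.
Proof.
move=> mg; apply: (@measurability _ _ S mtree setT g tree_cylinders) =>
  // _ [_ [v [B [mB ->]]] <-].
exact: mg.
Qed.

Lemma measurable_left_subtree : measurable_fun [set: mtree] (left_subtree :
  mtree -> mtree).
Proof. by apply: measurable_fun_treeP => v; exact: measurable_node. Qed.

Lemma measurable_right_subtree : measurable_fun [set: mtree] (right_subtree :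
  mtree -> mtree).
Proof. by apply: measurable_fun_treeP => v; exact: measurable_node. Qed.

Lemma measurable_root_time : measurable_fun [set: mtree] (fun w : mtree =>
  (w [::]).2 : R).
Proof.
exact: (measurableT_comp (@measurable_snd _ _ (Rd R d) (measurableTypeR R))
  (measurable_node [::])).
Qed.

Lemma measurable_root_position : measurable_fun [set: mtree] (fun w : mtree =>
  (w [::]).1 : Rd R d).
Proof.
exact: (measurableT_comp (@measurable_fst _ _ (Rd R d) (measurableTypeR R))
  (measurable_node [::])).
Qed.

Lemma measurable_alive n d' (S : measurableType d') (w : S -> mtree) (s : S ->
  R) :
  measurable_fun setT w -> measurable_fun setT s ->
  measurable_fun setT (fun x => alive n (w x) (s x)).
Proof.
elim: n w s => [|n IH] w s mw ms /=.
  by apply: measurable_fun_ltr => //;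
    exact: (measurableT_comp measurable_root_time mw).
have ms' : measurable_fun setT (fun x => s x - (w x [::]).2).
  by apply: measurable_funB => //;
    exact: (measurableT_comp measurable_root_time mw).
apply: measurable_and; apply: IH => //.
- exact: (measurableT_comp measurable_left_subtree mw).
- exact: (measurableT_comp measurable_right_subtree mw).
Qed.

Section observables.
Context {V : nmodType} {I : Type}.
Variable obs : I -> V -> \bar R.

(** Measurability of a [V]-valued function tested on a family of observables;
    it serves extended reals and complex vectors alike. *)
Definition obs_measurable d' (S : measurableType d') (g : S -> V) :=
  forall i, measurable_fun [set: S] (fun x => obs i (g x)).

Variables (op : Rd R d -> V -> V -> V) (c : Rd R d -> V).
Hypothesis op_measurable : forall d' (S : measurableType d') (xi : S -> Rd R d)
    (a b : S -> V), measurable_fun setT xi -> obs_measurable _ S a ->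
  obs_measurable _ S b -> obs_measurable _ S (fun x => op (xi x) (a x) (b x)).
Hypothesis c_measurable : obs_measurable _ _ c.

Lemma measurable_evaluate n d' (S : measurableType d') (w : S -> mtree)
  (s : S -> R) :
  measurable_fun setT w -> measurable_fun setT s ->
  obs_measurable _ S (fun x => evaluate op c n (w x) (s x)).
Proof.
move=> mw; have mW := measurableT_comp measurable_root_position mw.
have mT := measurableT_comp measurable_root_time mw.
have mL := measurableT_comp measurable_left_subtree mw.
have mR := measurableT_comp measurable_right_subtree mw.
elim: n w s mw mW mT mL mR => [|n IH] w s mw mW mT mL mR ms i /=;
  under eq_fun do rewrite (fun_if (obs i)).
  apply: measurable_fun_ifT => //; first exact: measurable_fun_ler.
  exact: measurableT_comp (c_measurable i) mW.
apply: measurable_fun_ifT => //; first exact: measurable_fun_ler.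
  exact: measurableT_comp (c_measurable i) mW.
have ms' : measurable_fun setT (fun x => s x - (w x [::]).2).
  exact: measurable_funB.
have IH' (u : S -> mtree) : measurable_fun setT u ->
    obs_measurable _ S (fun x => evaluate op c n (u x) (s x - (w x [::]).2)).
  move=> mu; apply: IH => //.
  - exact: measurableT_comp measurable_root_position mu.
  - exact: measurableT_comp measurable_root_time mu.
  - exact: measurableT_comp measurable_left_subtree mu.
  - exact: measurableT_comp measurable_right_subtree mu.
exact: (op_measurable _ _ _ _ _ mW (IH' _ mL) (IH' _ mR)).
Qed.

(* The domain is the countable union of the sets where the tree is alive at
   [n], on which the value is that of the recursion cut at [n], and of the set
   where the value is 0. *)
Lemma measurable_stopped d' (S : measurableType d') (w : S -> mtree) (s : S ->
  R) :
  measurable_fun setT w -> measurable_fun setT s ->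
  obs_measurable _ S (fun x => stopped op c (w x) (s x)).
Proof.
move=> mw ms i; pose E n := [set x | alive n (w x) (s x)].
have mE n : measurable (E n).
  have := measurable_alive n _ S w s mw ms measurableT [set true].
  by rewrite setTI; apply.
have mU : measurable (\bigcup_n E n) by exact: bigcupT_measurable.
rewrite -(setvU (\bigcup_n E n)); apply/measurable_funU => //;
  first exact: measurableC.
split.
  apply: (@eq_measurable_fun _ _ _ _ _ (cst (obs i 0))) => // x.
  rewrite inE => dead; rewrite stopped_dead// => n; apply/negP => sn.
  by apply: dead; exists n.
apply/measurable_fun_bigcup => // n.
apply: (@eq_measurable_fun _ _ _ _ _ (fun x => obs i (evaluate op c n (w x)
  (s x)))).
  by move=> x; rewrite inE => sn; rewrite (stopped_alive op c n).
exact/measurable_funTS/measurable_evaluate.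
Qed.

End observables.

End measurable_trees.

(** * The branching property as an identity of laws *)

Section measure_on_products.
Local Open Scope ereal_scope.

(** A finite measure on a product of four factors is determined by boxes: the
    identity is measurable from the sigma-algebra of the boxes, because its four
    coordinates are. *)
Lemma measure_prod4_unique d1 d2 d3 d4 (T1 : measurableType d1)
    (T2 : measurableType d2) (T3 : measurableType d3) (T4 : measurableType d4)
    (R : realType) (m1 m2 : {measure set ((T1 * T2) * (T3 * T4)) -> \bar R}) :
  m1 setT < +oo ->
  (forall A B C D, measurable A -> measurable B -> measurable C ->
    measurable D -> m1 ((A `*` B) `*` (C `*` D)) = m2 ((A `*` B) `*` (C `*` D)))
      ->
  forall X, measurable X -> m1 X = m2 X.
Proof.
move=> m1oo m12.
pose G : set (set ((T1 * T2) * (T3 * T4))) := [set X | exists A B C D,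
  [/\ measurable A, measurable B, measurable C & measurable D] /\
  X = (A `*` B) `*` (C `*` D)].
have GT : G setT.
  by exists setT, setT, setT, setT; split; [split|rewrite !setXTT].
have mG : measurable = <<s G >>.
  apply/seteqP; split=> [X mX|]; last first.
    apply: smallest_sub; first exact: sigma_algebra_measurable.
    by move=> _ [A [B [C [D [[mA mB mC mD] ->]]]]]; do 2?apply: measurableX.
  suff mid : measurable_fun [set: g_sigma_algebraType G]
      (id : g_sigma_algebraType G -> (T1 * T2) * (T3 * T4)).
    by have := mid measurableT X mX; rewrite setTI.
  apply/measurable_fun_pairP; split; apply/measurable_fun_pairP; split;
    move=> _ Y mY; rewrite setTI; apply: sub_sigma_algebra.
  - exists Y, setT, setT, setT; split=> //; apply/seteqP.
    by split=> [[[a b] [c e]]|[[a b] [c e]] [[]]].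
  - exists setT, Y, setT, setT; split=> //; apply/seteqP.
    by split=> [[[a b] [c e]]|[[a b] [c e]] [[]]].
  - exists setT, setT, Y, setT; split=> //; apply/seteqP.
    by split=> [[[a b] [c e]]|[[a b] [c e]] [_ []]].
  - exists setT, setT, setT, Y; split=> //; apply/seteqP.
    by split=> [[[a b] [c e]]|[[a b] [c e]] [_ []]].
move=> X mX; apply: (measure_unique G (fun=> setT)) => //.
- move=> _ _ [A [B [C [D [[mA mB mC mD] ->]]]]] [A' [B' [C' [D' [[mA' mB' mC'
  mD'] ->]]]]].
  exists (A `&` A'), (B `&` B'), (C `&` C'), (D `&` D').
  by split; [split; exact: measurableI|rewrite -!setXI].
- by rewrite bigcup_const//; exists 0%N.
- by move=> _ [A [B [C [D [[mA mB mC mD] ->]]]]]; exact: m12.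
Qed.

Lemma giry_prodE d1 d2 (T1 : measurableType d1) (T2 : measurableType d2)
    (R : realType) (m1 : giry T1 R) (m2 : giry T2 R) A B :
  measurable A -> measurable B -> giry_prod (m1, m2) (A `*` B) = m1 A * m2 B.
Proof. by move=> mA mB; exact: product_measure1E. Qed.

End measure_on_products.

Section points_of_Rd.
Context {R : realType} {d : nat}.

Lemma measurable_set1_Rd (a : Rd R d) : measurable [set a].
Proof.
have -> : [set a] = \bigcap_(i in [set: 'I_d])
  (@Defs.coord R d i @^-1` [set coord i a]).
  apply/seteqP; split=> [x -> //|x H]; apply/rowP => i; exact: (H i I).
apply: fin_bigcap_measurable; first exact: finite_finset.
move=> i _; rewrite -[X in measurable X]setTI.
by apply: measurable_coord => //; exact: measurable_set1.
Qed.

(** The origin is a measurable point, so a condition that is only known off the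
    origin, as for the kernel and for the laws of the cascade, extends to the
    whole space. *)
Lemma measurable_fun_off0 d' (T : measurableType d') (g : Rd R d -> T) :
  measurable_fun [set xi : Rd R d | xi != 0] g -> measurable_fun setT g.
Proof.
move=> mg; have m0 := measurable_set1_Rd (0 : Rd R d).
have E : [set xi : Rd R d | xi != 0] = ~` [set 0].
  by apply/seteqP; split=> x /= /eqP.
rewrite -(setUv [set 0]); apply/measurable_funU => //; first exact: measurableC.
split; last by rewrite -E.
move=> _ B mB; have [B0|B0] := pselect (B (g 0)).
  rewrite (_ : _ `&` _ = [set 0])//; apply/seteqP; split=> [x []//|x /= ->].
  by split.
rewrite (_ : _ `&` _ = set0); first exact: measurable0.
by rewrite -subset0 => x /= [-> /B0].
Qed.

Lemma measurable_subRd d' (S : measurableType d') (f g : S -> Rd R d) :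
  measurable_fun setT f -> measurable_fun setT g ->
  measurable_fun setT (fun x => f x - g x).
Proof.
move=> /measurable_fun_coordP mf /measurable_fun_coordP mg.
apply/measurable_fun_coordP => i.
apply: (@eq_measurable_fun _ _ _ _ _ (fun x => coord i (f x) - coord i (g x))).
  by move=> x _; rewrite /= /coord; apply/esym; rewrite !mxE.
by apply: measurable_funB; [exact: mf|exact: mg].
Qed.

End points_of_Rd.

Section cascade_law.
Context {R : realType} {d : nat} {h : Rd R d -> R} {K : cascade_family R d}.
Hypothesis hK : is_cascade h K.
Local Open Scope ereal_scope.
Notation mtree := (@mtree R d).

Definition sample (xi : Rd R d) : cas_Omega K xi -> mtree := @cas_tree R d K xi.

Lemma measurable_cas_T xi v :
  measurable_fun setT (cas_T K xi v : cas_Omega K xi -> measurableTypeR R).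
Proof. by move=> _ B mB;
  exact: (measurable_funPT (cas_T K xi v) measurableT B mB). Qed.

Lemma measurable_sample xi : measurable_fun setT (sample xi).
Proof.
apply: measurable_fun_treeP => v.
by apply/measurable_fun_pair; [exact: measurable_funPT|exact: measurable_cas_T].
Qed.

(** The law of the cascade as a point of the Giry monad, where kernels can be
    multiplied and composed. *)
Definition law_kernel (xi : Rd R d) : giry mtree R :=
  giry_map (measurable_sample xi) (cas_P K xi).

Lemma law_kernelE xi A : law_kernel xi A = cas_law K xi A.
Proof. by []. Qed.

Lemma measurable_law_kernel : measurable_fun setT law_kernel.
Proof.
apply: measurable_giry_codensity => // A mA.
by apply: measurable_fun_off0; exact: (cas_kernel hK).
Qed.

Variable xi : Rd R d.
Hypothesis xi0 : xi != 0%R.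
Notation P := (cas_P K xi).

Definition first_step (w : cas_Omega K xi) : measurableTypeR R * Rd R d :=
  (cas_T K xi [::] w, cas_W K xi [:: false] w).

Lemma measurable_first_step : measurable_fun setT first_step.
Proof.
by apply/measurable_fun_pair; [exact: measurable_cas_T|exact: measurable_funPT].
Qed.

Definition first_step_law : giry (measurableTypeR R * Rd R d)%type R :=
  giry_map measurable_first_step P.

Definition split_tree (w : cas_Omega K xi) :
    (measurableTypeR R * Rd R d) * (mtree * mtree) :=
  (first_step w, (left_subtree (sample xi w) : mtree,
                  right_subtree (sample xi w) : mtree)).

Lemma measurable_split_tree : measurable_fun setT split_tree.
Proof.
apply/measurable_fun_pair; first exact: measurable_first_step.
apply/measurable_fun_pair.
- exact: measurableT_comp measurable_left_subtree (measurable_sample xi).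
- exact: measurableT_comp measurable_right_subtree (measurable_sample xi).
Qed.

(** The conditional law of [split_tree] given the first step [z]. *)
Definition children_kernel (z : measurableTypeR R * Rd R d) :
    giry ((measurableTypeR R * Rd R d) * (mtree * mtree))%type R :=
  giry_prod (giry_ret z, giry_prod (law_kernel z.2, law_kernel (xi - z.2)%R)).

Lemma measurable_children_kernel : measurable_fun setT children_kernel.
Proof.
apply: (measurableT_comp measurable_giry_prod); apply/measurable_fun_pair.
  exact: measurable_giry_ret.
apply: (measurableT_comp measurable_giry_prod); apply/measurable_fun_pair.
  exact: measurableT_comp measurable_law_kernel _.
apply: measurableT_comp measurable_law_kernel _.
by apply: measurable_subRd => //; exact: measurable_cst.
Qed.

(** On boxes this is the branching clause of the cascade, at the root. *)
Lemma split_tree_law X : measurable X ->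
  giry_map measurable_split_tree P X =
  giry_bind first_step_law measurable_children_kernel X.
Proof.
apply: measure_prod4_unique.
  by rewrite (le_lt_trans sprobability_setT)// ltry.
move=> E C A1 A2 mE mC mA1 mA2.
have boxE z : children_kernel z ((E `*` C) `*` (A1 `*` A2)) =
    (z \in E `*` C)%:R%:E * (law_kernel z.2 A1 * law_kernel (xi - z.2)%R A2).
  by rewrite /children_kernel giry_prodE ?giry_prodE//; exact: measurableX.
have bindE : giry_bind first_step_law measurable_children_kernel
    ((E `*` C) `*` (A1 `*` A2)) =
  giry_int first_step_law (fun z => children_kernel z ((E `*` C)
    `*` (A1 `*` A2))).
  rewrite /giry_bind /=; apply: giry_int_map => //.
  by apply: measurable_giry_ev; do 2?apply: measurableX.
apply: (eq_trans _ (esym bindE)); rewrite giry_int_map//; last first.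
  apply: (measurableT_comp (measurable_giry_ev _)) => //.
    by do 2?apply: measurableX.
  exact: measurable_children_kernel.
have := @cas_branch _ _ _ _ hK xi [::] setT C E A1 A2 xi0 measurableT mC mE mA1
  mA2.
set ev := @cas_event R d K xi [::] setT E C => br.
have mev : measurable ev.
  have -> : ev = setT `&` first_step @^-1` (E `*` C).
    by apply/seteqP; split=> [w [_ ? ?]|w [_ [? ?]]]; split.
  exact: measurable_first_step measurableT _ (measurableX mE mC).
transitivity (P (ev `&` [set w | A1 (subtree [:: false] (sample xi w)) /\
    A2 (subtree [:: true] (sample xi w))])).
  congr (P _); apply/seteqP; split=> w.
    by move=> [[? ?] [? ?]].
  by move=> [[_ ? ?] [? ?]].
rewrite br integral_mkcond; apply: eq_integral => w _.
apply: (eq_trans _ (esym (boxE (first_step w)))).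
rewrite !law_kernelE patchE.
have [inev|nev] := boolP (w \in ev).
  rewrite mem_set ?mul1e; last by move: inev; rewrite inE => -[].
  by rewrite (cas_children hK)// (cas_root hK).
rewrite memNset ?mul0e// => -[? ?]; move/negP: nev; apply.
by rewrite inE; split.
Qed.

(** Tonelli's theorem for the law of the split tree. *)
Lemma branching_integral (G1 G2 : (measurableTypeR R * Rd R d) * mtree ->
  \bar R) :
  measurable_fun setT G1 -> measurable_fun setT G2 ->
  (forall p, 0 <= G1 p) -> (forall p, 0 <= G2 p) ->
  \int[P]_w (G1 (first_step w, left_subtree (sample xi w)) *
             G2 (first_step w, right_subtree (sample xi w))) =
  \int[first_step_law]_z ((\int[law_kernel z.2]_u G1 (z, u)) *
                          (\int[law_kernel (xi - z.2)%R]_u G2 (z, u))).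
Proof.
move=> mG1 mG2 G10 G20.
pose H (p : (measurableTypeR R * Rd R d) * (mtree * mtree)) :=
  G1 (p.1, p.2.1) * G2 (p.1, p.2.2).
have mH : measurable_fun setT H.
  apply: emeasurable_funM.
    apply: (measurableT_comp mG1); apply: measurable_fun_pair => //.
    exact: (measurableT_comp measurable_fst measurable_snd).
  apply: (measurableT_comp mG2); apply: measurable_fun_pair => //.
  exact: (measurableT_comp measurable_snd measurable_snd).
have H0 p : 0 <= H p by rewrite mule_ge0.
transitivity (giry_int (giry_map measurable_split_tree P) H).
  by rewrite giry_int_map.
transitivity (giry_int (giry_bind first_step_law measurable_children_kernel) H).
  by apply: eq_measure_integral => A mA _; exact: split_tree_law.
rewrite giry_int_bind//; apply: eq_integral => z _; rewrite /children_kernel.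
move: (law_kernel z.2) (law_kernel (xi - z.2)%R) => k1 k2.
rewrite giry_int_prod1// giry_int_ret; last first.
  have -> : (fun x => giry_int (giry_prod (k1, k2))
      (fun y => H (x, y))) =
    (fun x => giry_int (giry_prod (giry_ret x,
      giry_prod (k1, k2))) H).
    apply/funext => x; rewrite [RHS]giry_int_prod2//; congr giry_int.
    apply/funext => y; rewrite giry_int_ret//.
    by apply: (measurableT_comp mH); exact: measurable_fun_pair.
  apply: (measurableT_comp (measurable_giry_int mH H0)).
  apply: (measurableT_comp measurable_giry_prod); apply/measurable_fun_pair.
    exact: measurable_giry_ret.
  exact: measurable_cst.
have mHz : measurable_fun setT (fun y => H (z, y)).
  by apply: (measurableT_comp mH); exact: measurable_fun_pair.
have m1 : measurable_fun setT (fun u => G1 (z, u)).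
  by apply: (measurableT_comp mG1); exact: measurable_fun_pair.
have m2 : measurable_fun setT (fun u => G2 (z, u)).
  by apply: (measurableT_comp mG2); exact: measurable_fun_pair.
rewrite giry_int_prod1// /giry_int /H/=.
transitivity (\int[k1]_u (G1 (z, u) * \int[k2]_v G2 (z, v))).
  by apply: eq_integral => u _; rewrite ge0_integralZl.
by rewrite ge0_integralZr// integral_ge0.
Qed.

End cascade_law.

(** * Densities, null points and translations *)

Section density.
Local Open Scope ereal_scope.
Context d (T : measurableType d) (R : realType).
Variables (m n : {measure set T -> \bar R}) (p : T -> R).
Hypotheses (mp : measurable_fun setT p) (p0 : forall x, (0 <= p x)%R).
Hypothesis nE : forall A, measurable A -> n A = \int[m]_(x in A) (p x)%:E.

Import HBNNSimple.

Let integral_density_nnsfun (f : {nnsfun T >-> R}) :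
  \int[n]_x (f x)%:E = \int[m]_x ((p x)%:E * (f x)%:E).
Proof.
have mEp : measurable_fun setT (fun x => (p x)%:E) by exact/measurable_EFinP.
have m1 r : measurable_fun setT (fun x => (r * \1_(f @^-1` [set r]) x)%:E).
  apply/measurable_EFinP; apply: measurable_funM => //.
rewrite integralT_nnsfun sintegralE.
under [RHS]eq_integral.
  move=> x _; rewrite fimfunE -fsumEFin// ge0_mule_fsumr; first over.
  by move=> r; rewrite EFinM nnfun_muleindic_ge0.
rewrite ge0_integral_fsum//; last 2 first.
- by move=> r; apply: emeasurable_funM => //; exact: m1.
- by move=> r x _; apply: mule_ge0;
  [rewrite lee_fin|rewrite EFinM nnfun_muleindic_ge0].
apply: eq_fsbigr => r _.
have mA : measurable (f @^-1` [set r]) by exact: measurable_sfunP.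
have [r0|r0] := leP 0%R r; last first.
  rewrite preimage_nnfun0// measure0 mule0 integral0_eq// => x _.
  by rewrite indic0 mulr0 mule0.
rewrite nE// integral_mkcond -ge0_integralZl//; last 2 first.
- by apply/(measurable_restrictT _ mA); exact: measurable_funTS.
- by move=> x _; rewrite patchE; case: ifPn => // _; rewrite lee_fin.
apply: eq_integral => x _; rewrite patchE indicE.
by case: ifPn => xA; rewrite -?EFinM ?mulr1 ?mulr0 ?mule0// mulrC.
Qed.

Lemma ge0_integral_density (g : T -> \bar R) :
  measurable_fun setT g -> (forall x, 0 <= g x) ->
  \int[n]_x g x = \int[m]_x ((p x)%:E * g x).
Proof.
move=> mg g0.
have mEp : measurable_fun setT (fun x => (p x)%:E) by exact/measurable_EFinP.
pose g_ := nnsfun_approx measurableT mg.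
have cvg_g x : (g_ k x)%:E @[k --> \oo] --> g x by exact: cvg_nnsfun_approx.
transitivity (limn (fun k => \int[n]_x (g_ k x)%:E)).
  rewrite -monotone_convergence//.
  - by apply: eq_integral => x _; apply/esym/cvg_lim => //; exact: cvg_g.
  - by move=> k; exact/measurable_EFinP.
  - by move=> k x _; rewrite lee_fin.
  - by move=> x _ a b ab; rewrite lee_fin; exact/lefP/nd_nnsfun_approx.
under eq_fun do rewrite integral_density_nnsfun.
rewrite -monotone_convergence//; last 3 first.
- by move=> k; apply: emeasurable_funM => //; exact/measurable_EFinP.
- by move=> k x _; rewrite mule_ge0// lee_fin.
- move=> x _ a b ab; apply: lee_wpmul2l; first by rewrite lee_fin.
  by rewrite lee_fin; exact/lefP/nd_nnsfun_approx.
apply: eq_integral => x _; apply/cvg_lim => //.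
by apply: cvgeZl => //; exact: cvg_g.
Qed.

Lemma integral_density (g : T -> \bar R) : measurable_fun setT g ->
  \int[n]_x g x = \int[m]_x ((p x)%:E * g x).
Proof.
move=> mg; rewrite integralE [RHS]integralE.
rewrite !ge0_integral_density//; last 2 first.
- exact: measurable_funeneg.
- exact: measurable_funepos.
congr (_ - _); apply: eq_integral => x _.
- by rewrite !funeposE maxe_pMr ?lee_fin// mule0.
- by rewrite !funenegE -muleN maxe_pMr ?lee_fin// mule0.
Qed.

End density.

Section lebesgue_facts.
Context {R : realType}.
Local Open Scope ereal_scope.
Notation mu1 := (@lebesgue_measure R).

Lemma leb_set1 d (a : Rd R d) : (0 < d)%N -> leb d [set a] = 0.
Proof.
case: d a => // d a _.
have := @leb_box R _ a a (fun i => lexx _).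
rewrite big_ord_recl subrr mul0r; apply: eq_trans; congr (leb _ _);
  apply/seteqP.
split=> [x -> i|x H]; first by rewrite in_itv/= lexx.
apply/rowP => i; apply/eqP; rewrite eq_le andbC.
by have := H i; rewrite in_itv.
Qed.

(** Lebesgue measure and its translate agree on half-open intervals. *)
Lemma ge0_integral_translation (a : R) (g : R -> \bar R) :
  measurable_fun setT g -> (forall x, 0 <= g x) ->
  \int[mu1]_x g (x - a)%R = \int[mu1]_x g x.
Proof.
move=> mg g0.
have mt : measurable_fun setT (fun x : measurableTypeR R =>
  x - a : measurableTypeR R)%R.
  exact: measurable_funB.
pose nu := measure_function_pushforward__canonical__measure_function_Measure
  mu1 mt.
have nuE A : measurable A -> mu1 A = nu A.
  apply: lebesgue_measure_unique => _ [[u v]] _ <-.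
  rewrite /nu/= /pushforward.
  rewrite (_ : _ @^-1` _ = `](u + a)%R, (v + a)%R]%classic); last first.
    by apply/seteqP; split=> x /=; rewrite !in_itv/= ltrBrDr lerBlDr.
  rewrite !lebesgue_measure_itv/= !lte_fin ltrD2r.
  by case: ifP => // _; rewrite -!EFinB; congr EFin; ring.
transitivity (\int[nu]_x g x).
  by rewrite /nu/= ge0_integral_pushforward.
by apply: eq_measure_integral => A mA _; apply/esym/nuE.
Qed.

End lebesgue_facts.

(** * The first step of the cascade *)

Section first_generation.
Context {R : realType} {d : nat} {h : Rd R d -> R} {K : cascade_family R d}.
Hypothesis hK : is_cascade h K.
Hypothesis hh : standard_majorizing_kernel h.
Local Open Scope ereal_scope.
Notation mtree := (@mtree R d).
Variable xi : Rd R d.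
Hypothesis xi0 : xi != 0%R.
Notation P := (cas_P K xi).
Notation first_step := (@first_step R d K xi).
Notation first_step_law := (@first_step_law R d K xi).
Notation sample := (@sample R d K).
Notation law_kernel := (@law_kernel R d K).

Definition time_law : giry (measurableTypeR R) R :=
  giry_map (measurable_cas_T xi [::]) P.

Definition child_law : giry (Rd R d) R :=
  giry_map (measurable_funPT (cas_W K xi [:: false])) P.

Notation rate := (enorm xi ^+ 2)%R.

Lemma rate_gt0 : (0 < rate)%R.
Proof. by rewrite exprn_gt0// enorm_gt0. Qed.

(** The one-step clause of the cascade at the root, where [W] is constant. *)
Lemma first_step_box E C : measurable E -> measurable C ->
  first_step_law (E `*` C) =
  exponential_prob rate E * \int[leb d]_(eta in C) (Hker h eta xi)%:E.
Proof.
move=> mE mC.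
have := @cas_step _ _ _ _ hK xi [::] setT C E xi0 measurableT mC mE.
rewrite (_ : [set w | setT (cas_W K xi [::] w)] = setT)//.
under eq_integral do rewrite (cas_root hK)//.
rewrite integral_cst// [X in _ * X]probability_setT mule1 => <-.
by congr (P _); apply/seteqP; split=> [w [? ?]|w [_ ? ?]].
Qed.

Lemma exponential_setT : exponential_prob rate setT = 1.
Proof. exact: integral_exponential_pdf rate_gt0. Qed.

Lemma child_lawE C : measurable C ->
  child_law C = \int[leb d]_(eta in C) (Hker h eta xi)%:E.
Proof.
move=> mC; rewrite -[RHS]mul1e -exponential_setT -first_step_box//.
by congr (P _); apply/seteqP; split=> [w ?|w [_ ?]].
Qed.

Lemma time_lawE E : measurable E ->
  time_law E = \int[lebesgue_measure]_(s in E) (exponential_pdf rate s)%:E.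
Proof.
move=> mE; transitivity (exponential_prob rate E * child_law setT).
  rewrite child_lawE// -first_step_box//.
  by congr (P _); apply/seteqP; split=> [w ?|w [? _]].
by rewrite [child_law _]probability_setT mule1.
Qed.

Lemma first_step_lawE X : measurable X ->
  giry_prod (time_law, child_law) X = first_step_law X.
Proof.
apply: product_measure_unique => E C mE mC.
apply: (eq_trans (first_step_box _ _ mE mC)); apply/esym.
by congr (_ * _); [exact: time_lawE|exact: child_lawE].
Qed.

Lemma measurable_kernel_h : measurable_fun setT h.
Proof. by apply: measurable_fun_off0; have [] := hh. Qed.

Lemma measurable_Hker : measurable_fun setT (fun eta => Hker h eta xi).
Proof.
apply: measurable_funM => //; apply: measurable_funM;
  first exact: measurable_kernel_h.
apply: (measurableT_comp measurable_kernel_h).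
by apply: measurable_subRd => //; exact: measurable_cst.
Qed.

(* The kernel is positive off the two null points 0 and xi. *)
Let Hker_abs : (0 < d)%N ->
  ae_eq (leb d) setT (fun eta => (Hker h eta xi)%:E) (fun eta =>
    `|Hker h eta xi|%:E).
Proof.
move=> d0; exists ([set 0%R] `|` [set xi]); split.
- by apply: measurableU; exact: measurable_set1_Rd.
- rewrite measureU0 ?leb_set1//; exact: measurable_set1_Rd.
move=> eta /= H; apply: contrapT => /not_orP[/eqP eta0 /eqP etaxi];
  apply: H => _.
have [_ h0 _] := hh.
have ? : (0 < h eta)%R by exact: h0.
have ? : (0 < h (xi - eta))%R by apply: h0; rewrite subr_eq0 eq_sym.
have ? : (0 < h xi)%R by exact: h0.
rewrite ger0_norm// divr_ge0// ltW// ?mulr_gt0// enorm_gt0//.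
Qed.

Lemma integral_child_law (g : Rd R d -> \bar R) : (0 < d)%N ->
  measurable_fun setT g ->
  \int[child_law]_eta g eta = \int[leb d]_eta ((Hker h eta xi)%:E * g eta).
Proof.
move=> d0 mg; have mH := measurable_Hker.
have mEH : measurable_fun setT (fun eta => (Hker h eta xi)%:E).
  exact/measurable_EFinP.
have mEH' : measurable_fun setT (fun eta => `|Hker h eta xi|%:E).
  exact/measurable_EFinP/measurableT_comp.
rewrite (integral_density _ _ _ (leb d) child_law (fun eta =>
  `|Hker h eta xi|%R))//.
- apply: ae_eq_integral => //; [exact: emeasurable_funM..|].
  apply: filterS (Hker_abs d0) => eta /= + _; by move=> ->.
- exact: measurableT_comp.
- move=> A mA; rewrite [LHS]child_lawE//.
  apply: ae_eq_integral => //; [exact: measurable_funTS..|].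
  by apply: filterS (Hker_abs d0) => eta /= + _; apply.
Qed.

Lemma integral_time_law (g : R -> \bar R) : measurable_fun setT g ->
  \int[time_law]_s g s =
  \int[lebesgue_measure]_s ((exponential_pdf rate s)%:E * g s).
Proof.
move=> mg; apply: integral_density => //;
  first exact: measurable_exponential_pdf.
- by move=> s; rewrite exponential_pdf_ge0// ltW// rate_gt0.
- exact: time_lawE.
Qed.

(** The real argument of [g] is the time left to the cascade started at [eta]. *)
Definition mean (g : mtree * measurableTypeR R -> \bar R) (eta : Rd R d) (r : R)
  :=
  \int[cas_P K eta]_w g (sample eta w, r).

Lemma measurable_mean (g : mtree * measurableTypeR R -> \bar R) :
  measurable_fun setT g -> (forall p, 0 <= g p) ->
  measurable_fun setT
    (fun p : Rd R d * measurableTypeR R => mean g p.1 p.2).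
Proof.
move=> mg g0.
apply: (@eq_measurable_fun _ _ _ _ _ (fun p : Rd R d * measurableTypeR R =>
    giry_int (giry_prod (law_kernel p.1, giry_ret p.2)) g)).
  move=> [eta r] _ /=; rewrite giry_int_prod2// giry_int_ret; last first.
    apply: (@eq_measurable_fun _ _ _ _ _ (fun y : measurableTypeR R =>
      giry_int (giry_prod (law_kernel eta, giry_ret y)) g)).
      move=> y _; rewrite giry_int_prod1//; congr giry_int; apply/funext => x.
      by rewrite giry_int_ret//; apply: (measurableT_comp mg);
        exact: measurable_fun_pair.
    apply: (measurableT_comp (measurable_giry_int mg g0)).
    apply: (measurableT_comp measurable_giry_prod); apply/measurable_fun_pair.
      exact: measurable_cst.
    exact: measurable_giry_ret.
  rewrite giry_int_map//.
  by apply: (measurableT_comp mg); exact: measurable_fun_pair.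
apply: (measurableT_comp (measurable_giry_int mg g0)).
apply: (measurableT_comp measurable_giry_prod); apply/measurable_fun_pair.
  exact: measurableT_comp (measurable_law_kernel hK) _.
exact: measurableT_comp measurable_giry_ret _.
Qed.

Lemma mean_ge0 g eta r : (forall p, 0 <= g p) -> 0 <= mean g eta r.
Proof. by move=> g0; apply: integral_ge0. Qed.

(** What the two subtrees contribute at time [t] if the root branches before [t];
    [mean_product] is the conditional expectation of this given the first
    step. *)
Definition split_before (t : R) (g1 g2 : mtree * measurableTypeR R -> \bar R)
    (u : mtree) : \bar R :=
  if ((u [::]).2 < t)%R
  then g1 (left_subtree u, t - (u [::]).2)%R * g2 (right_subtree u,
    t - (u [::]).2)%R
  else 0.

Definition mean_product (t : R) (g1 g2 : mtree * measurableTypeR R -> \bar R)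
    (z : measurableTypeR R * Rd R d) : \bar R :=
  if (z.1 < t)%R then mean g1 z.2 (t - z.1)%R * mean g2 (xi - z.2)%R (t - z.1)%R
  else 0.

Lemma measurable_before (t : R) :
  measurable_fun setT (fun z : measurableTypeR R * Rd R d => (z.1 < t)%R).
Proof. by apply: measurable_fun_ltr => //; exact: measurable_cst. Qed.

Lemma measurable_mean_left t g : measurable_fun setT g -> (forall p, 0 <= g p)
  ->
  measurable_fun setT (fun z : measurableTypeR R * Rd R d =>
    mean g z.2 (t - z.1)%R).
Proof.
move=> mg g0.
pose s (z : measurableTypeR R * Rd R d) : Rd R d * measurableTypeR R :=
  (z.2, t - z.1)%R.
suff ms : measurable_fun setT s.
  exact: (measurableT_comp (measurable_mean g mg g0) ms).
apply: measurable_fun_pair => //.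
by apply: measurable_funB => //; exact: measurable_cst.
Qed.

Lemma measurable_mean_right t g : measurable_fun setT g -> (forall p, 0 <= g p)
  ->
  measurable_fun setT (fun z : measurableTypeR R * Rd R d =>
    mean g (xi - z.2)%R (t - z.1)%R).
Proof.
move=> mg g0.
pose s (z : measurableTypeR R * Rd R d) : Rd R d * measurableTypeR R :=
  (xi - z.2, t - z.1)%R.
suff ms : measurable_fun setT s.
  exact: (measurableT_comp (measurable_mean g mg g0) ms).
apply: measurable_fun_pair.
  by apply: measurable_subRd => //; exact: measurable_cst.
by apply: measurable_funB => //; exact: measurable_cst.
Qed.

Lemma measurable_mean_product t g1 g2 :
  measurable_fun setT g1 -> measurable_fun setT g2 ->
  (forall p, 0 <= g1 p) -> (forall p, 0 <= g2 p) ->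
  measurable_fun setT (mean_product t g1 g2).
Proof.
move=> mg1 mg2 g10 g20; apply: measurable_fun_ifT => //.
  exact: measurable_before.
apply: emeasurable_funM; first exact: measurable_mean_left.
exact: measurable_mean_right.
Qed.

Lemma mean_branching t g1 g2 :
  measurable_fun setT g1 -> measurable_fun setT g2 ->
  (forall p, 0 <= g1 p) -> (forall p, 0 <= g2 p) ->
  \int[P]_w split_before t g1 g2 (sample xi w) =
  \int[giry_prod (time_law, child_law)]_z mean_product t g1 g2 z.
Proof.
move=> mg1 mg2 g10 g20.
pose G1 (p : (measurableTypeR R * Rd R d) * mtree) :=
  if (p.1.1 < t)%R then g1 (p.2, t - p.1.1)%R else 0.
pose G2 (p : (measurableTypeR R * Rd R d) * mtree) := g2 (p.2, t - p.1.1)%R.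
have mt : measurable_fun setT (fun p : (measurableTypeR R * Rd R d) * mtree =>
    t - p.1.1 : measurableTypeR R)%R.
  apply: measurable_funB; first exact: measurable_cst.
  exact: (measurableT_comp measurable_fst measurable_fst).
have mg (g : mtree * measurableTypeR R -> \bar R) : measurable_fun setT g ->
    measurable_fun setT (fun p : (measurableTypeR R * Rd R d) * mtree =>
      g (p.2, t - p.1.1)%R).
  by move=> mg; apply: (measurableT_comp mg); exact: measurable_fun_pair.
have mG1 : measurable_fun setT G1.
  apply: measurable_fun_ifT => //; last exact: mg.
  exact: measurableT_comp (measurable_before t) measurable_fst.
have mG2 : measurable_fun setT G2 by exact: mg.
have G10 p : 0 <= G1 p by rewrite /G1; case: ifP.
have G20 p : 0 <= G2 p by exact: g20.
transitivity (\int[P]_w (G1 (first_step w, left_subtree (sample xi w)) *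
                         G2 (first_step w, right_subtree (sample xi w)))).
  apply: eq_integral => w _; rewrite /split_before /G1 /G2 /=.
  by case: ifP => // _; rewrite mul0e.
rewrite (branching_integral hK xi xi0 _ _ mG1 mG2 G10 G20).
transitivity (\int[first_step_law]_z mean_product t g1 g2 z).
  apply: eq_integral => z _.
  have E g eta r : measurable_fun setT g -> (forall p, 0 <= g p) ->
      \int[law_kernel eta]_u g (u, r) = mean g eta r.
    move=> mg' g0; apply: giry_int_map => //.
    by apply: (measurableT_comp mg'); exact: measurable_fun_pair.
  have -> : \int[law_kernel (xi - z.2)%R]_u G2 (z, u) =
      mean g2 (xi - z.2)%R (t - z.1)%R by exact: (E g2 (xi - z.2)%R (t - z.1)%R
        mg2 g20).
  rewrite /mean_product; case: ifPn => zt.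
    by congr (_ * _); rewrite -(E g1 _ _ mg1 g10); apply: eq_integral => u _;
      rewrite /G1/= zt.
  rewrite integral0_eq ?mul0e// => u _.
  by rewrite /G1/= (negbTE zt).
by apply: eq_measure_integral => A mA _; apply/esym/first_step_lawE.
Qed.

(** For each of the countably many vertices, an exponential law of any rate gives
    no mass to the nonpositive reals. *)
Lemma positive_times_ae : {ae P, forall w, positive_times (sample xi w)}.
Proof.
have H v : P [set w | (cas_T K xi v w <= 0)%R] = 0.
  have := @cas_step _ _ _ _ hK xi v setT setT `]-oo,
    0%R]%classic xi0 measurableT
    measurableT (measurable_itv _).
  rewrite (_ : @cas_event R d K xi v _ _ _ = [set w | (cas_T K xi v w <= 0)%R]);
    last first.
    by apply/seteqP; split=> [w [_ + _]|w ?]; [|split => //]; rewrite /= in_itv.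
  move=> ->; apply: integral0_eq => w _.
  rewrite [X in X * _](_ : _ = 0) ?mul0e// /exponential_prob.
  rewrite -integral_itv_bndo_bndc.
    apply: integral0_eq => s; rewrite /= in_itv/= => s0.
    by rewrite lt0_exponential_pdf.
  apply: measurable_funTS; apply/measurable_EFinP.
  exact: measurable_exponential_pdf.
have : {ae P, forall w, forall n,
    if unpickle n is Some v then (0 < cas_T K xi v w)%R else true}.
  apply/ae_foralln => n; case: unpickle => [v|]; last exact: aeW.
  exists [set w | (cas_T K xi v w <= 0)%R]; split; last 2 first.
  - exact: H.
  - by move=> w /= /negP; rewrite -leNgt.
  - rewrite (_ : mkset _ = setT `&` (cas_T K xi v @^-1` `]-oo, 0%R])).
      exact: measurable_cas_T.
    by apply/seteqP; split=> [w|w [_]]; rewrite /= in_itv.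
by apply: filterS => w Hw v; have := Hw (pickle v); rewrite pickleK.
Qed.

End first_generation.

(** * Measurability and pathwise majorization of the processes *)

Section measurable_complex_vectors.
Context {R : realType} {d : nat}.
Notation Cd := 'rV[complex R]_d.

Definition rcoord_obs (p : bool * 'I_d) (z : Cd) : \bar R := (rcoord p z)%:E.

Let cmeasurable d' (S : measurableType d') (g : S -> complex R) :=
  measurable_fun setT (fun s => complex.Re (g s)) /\
  measurable_fun setT (fun s => complex.Im (g s)).

Let cmeasurableD d' (S : measurableType d') (g k : S -> complex R) :
  cmeasurable _ S g -> cmeasurable _ S k -> cmeasurable _ S (fun s =>
    g s + k s).
Proof.
move=> [g1 g2] [k1 k2]; split.
- apply: (@eq_measurable_fun _ _ _ _ _ (fun s => complex.Re (g s)
  + complex.Re (k s))).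
    by move=> s _; case: (g s) (k s) => ? ? [].
  exact: measurable_funD.
- apply: (@eq_measurable_fun _ _ _ _ _ (fun s => complex.Im (g s)
  + complex.Im (k s))).
    by move=> s _; case: (g s) (k s) => ? ? [].
  exact: measurable_funD.
Qed.

Let cmeasurableM d' (S : measurableType d') (g k : S -> complex R) :
  cmeasurable _ S g -> cmeasurable _ S k -> cmeasurable _ S (fun s =>
    g s * k s).
Proof.
move=> [g1 g2] [k1 k2]; split.
- apply: (@eq_measurable_fun _ _ _ _ _ (fun s =>
    complex.Re (g s) * complex.Re (k s) - complex.Im (g s) * complex.Im (k s))).
    by move=> s _; case: (g s) (k s) => ? ? [].
  by apply: measurable_funB; exact: measurable_funM.
- apply: (@eq_measurable_fun _ _ _ _ _ (fun s =>
    complex.Re (g s) * complex.Im (k s) + complex.Im (g s) * complex.Re (k s))).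
    by move=> s _; case: (g s) (k s) => ? ? [].
  by apply: measurable_funD; exact: measurable_funM.
Qed.

Let cmeasurable_cst d' (S : measurableType d') (c : complex R) :
  cmeasurable _ S (fun=> c).
Proof. by split; exact: measurable_cst. Qed.

Let cmeasurable_sum d' (S : measurableType d') (I : finType) (g : I -> S ->
  complex R) :
  (forall i, cmeasurable _ S (g i)) -> cmeasurable _ S (fun s => \sum_i g i s).
Proof.
move=> mg; elim: (index_enum I) => [|i s IH].
  by under [X in cmeasurable _ _ X]eq_fun do rewrite big_nil.
by under [X in cmeasurable _ _ X]eq_fun do rewrite big_cons;
  exact: cmeasurableD.
Qed.

Let cmeasurable_entry d' (S : measurableType d') (g : S -> Cd) j :
  obs_measurable rcoord_obs _ S g -> cmeasurable _ S (fun s => g s 0 j).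
Proof.
move=> mg; split; apply/measurable_EFinP.
- exact: mg (false, j).
- exact: mg (true, j).
Qed.

Lemma measurable_enorm : measurable_fun setT (@enorm R d).
Proof.
have -> : @enorm R d = Num.sqrt \o (fun x => \sum_i coord i x ^+ 2) by [].
apply: (measurableT_comp (continuous_measurable_fun (@sqrt_continuous R))).
apply: measurable_sum => i; apply: measurable_funX; exact: measurable_coord.
Qed.

Lemma measurable_odot d' (S : measurableType d') (xi : S -> Rd R d) (a b : S ->
  Cd) :
  measurable_fun setT xi -> obs_measurable rcoord_obs _ S a ->
  obs_measurable rcoord_obs _ S b ->
  obs_measurable rcoord_obs _ S (fun s => odot (xi s) (a s) (b s)).
Proof.
move=> mxi ma mb.
have mu j : cmeasurable _ S (fun s => unit_dir (xi s) 0 j).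
  under [X in cmeasurable _ _ X]eq_fun do rewrite mxE.
  split => /=; last exact: measurable_cst.
  apply: measurable_funM.
    exact: (measurableT_comp (measurable_coord _) mxi).
  under eq_fun do rewrite -powR_inv1 ?sqrtr_ge0//.
  apply: (measurableT_comp (measurable_powR _)).
  exact: (measurableT_comp measurable_enorm mxi).
have mdot (c : S -> Cd) : obs_measurable rcoord_obs _ S c ->
    cmeasurable _ S (fun s => dotC (unit_dir (xi s)) (c s)).
  by move=> mc; apply: cmeasurable_sum => j; apply: cmeasurableM => //;
    exact: cmeasurable_entry.
have mproj (c : S -> Cd) j : obs_measurable rcoord_obs _ S c ->
    cmeasurable _ S (fun s => proj_perp (xi s) (c s) 0 j).
  move=> mc.
  have -> : (fun s => proj_perp (xi s) (c s) 0 j) = (fun s => c s 0 j +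
      -1 * (dotC (unit_dir (xi s)) (c s) * unit_dir (xi s) 0 j)).
    by apply/funext => s; rewrite !mxE mulN1r.
  apply: cmeasurableD; first exact: cmeasurable_entry.
  by apply: cmeasurableM => //; apply: cmeasurableM => //; exact: mdot.
have mo j : cmeasurable _ S (fun s => odot (xi s) (a s) (b s) 0 j).
  have -> : (fun s => odot (xi s) (a s) (b s) 0 j) = (fun s => (- 'i / 2)%C *
      (dotC (unit_dir (xi s)) (b s) * proj_perp (xi s) (a s) 0 j +
       dotC (unit_dir (xi s)) (a s) * proj_perp (xi s) (b s) 0 j)).
    by apply/funext => s; rewrite /odot !mxE.
  apply: cmeasurableM => //.
  by apply: cmeasurableD; apply: cmeasurableM; do ?[exact: mdot|exact: mproj].
by move=> [[] j]; apply/measurable_EFinP; have [] := mo j.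
Qed.

Lemma measurable_cnorm d' (S : measurableType d') (g : S -> Cd) :
  obs_measurable rcoord_obs _ S g -> measurable_fun setT (fun s => cnorm (g s)).
Proof.
move=> mg; apply: (measurableT_comp (continuous_measurable_fun
  (@sqrt_continuous R))).
apply: measurable_sum => j.
by apply: measurable_funD; apply: measurable_funX;
  have [] := cmeasurable_entry _ _ g j mg.
Qed.

End measurable_complex_vectors.

Section processes.
Context {R : realType} {d : nat}.
Notation Cd := 'rV[complex R]_d.
Notation mtree := (@mtree R d).
Variables (chi0 : Rd R d -> Cd) (f : R -> R).
Hypotheses (hchi0 : measurable_Cd chi0) (hf : class_S f).
Local Open Scope ereal_scope.

Definition majorant (eta : Rd R d) : \bar R := (f (cnorm (chi0 eta) / 2))%:E.

(** [Yproc] uncurried, since the branching property needs joint measurability in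
    the tree and the time; likewise for [Xproc]. *)
Definition Yfun (p : mtree * measurableTypeR R) : \bar R :=
  Yproc majorant p.1 p.2.

Definition Xfun (p : mtree * measurableTypeR R) : Cd := Xproc chi0 p.1 p.2.

Definition Nfun (p : mtree * measurableTypeR R) : \bar R := (cnorm (Xfun p))%:E.

Let half_cnorm_ge0 (z : Cd) : (0 <= cnorm z / 2)%R.
Proof. by rewrite divr_ge0 ?cnorm_ge0. Qed.

Let f_ge0 x : (0 <= x)%R -> (0 <= f x)%R.
Proof. by have [f0 _ _ _ _] := hf; exact: f0. Qed.

Let f_mul x y : (0 <= x)%R -> (0 <= y)%R -> (f (x * y) <= f x * f y)%R.
Proof. by have [_ fM _ _ _] := hf; exact: fM. Qed.

Let chi0_measurable : obs_measurable rcoord_obs _ _ chi0.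
Proof. by move=> [[] j]; apply/measurable_EFinP; have [] := hchi0 j. Qed.

Lemma measurable_Xfun p : measurable_fun setT (fun q => rcoord p (Xfun q)).
Proof.
apply/measurable_EFinP.
apply: (measurable_stopped rcoord_obs odot chi0) => //.
exact: measurable_odot.
Qed.

Lemma measurable_Nfun : measurable_fun setT Nfun.
Proof.
apply/measurable_EFinP; apply: measurable_cnorm => p; apply/measurable_EFinP.
exact: measurable_Xfun.
Qed.

Lemma measurable_Yfun : measurable_fun setT Yfun.
Proof.
apply: (measurable_stopped (fun (_ : unit) (x : \bar R) => x) (fun _ => mule)
  majorant _ _ _ _ _ _ _ _ tt) => //.
  move=> d' S xi a b _ ma mb i; exact: emeasurable_funM (ma tt) (mb tt).
move=> i; apply/measurable_EFinP.
apply: (measurable_class_S hf _ _ (fun eta => cnorm (chi0 eta) / 2)%R) => //.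
by apply: measurable_funM => //; exact: measurable_cnorm.
Qed.

Lemma stopped_majorant_ge0 (u : mtree) s : 0 <= Yproc majorant u s.
Proof.
have [[n us]|dead] := pselect (exists n, alive n u s); last first.
  by rewrite /Yproc stopped_dead// => n; apply/negP => us; apply: dead;
    exists n.
rewrite /Yproc (stopped_alive _ _ n)//; elim: n u s {us} => [|n IH] u s /=;
  case: ifP => // _; rewrite ?lee_fin ?f_ge0// mule_ge0//.
Qed.

Lemma Yfun_ge0 p : 0 <= Yfun p. Proof. exact: stopped_majorant_ge0. Qed.

Lemma Nfun_ge0 p : 0 <= Nfun p. Proof. by rewrite lee_fin cnorm_ge0. Qed.

(** Pathwise majorization: [odot] costs the factor 1/2, so halving the leaves
    turns it into a product, which [f] dominates by submultiplicativity. *)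
Lemma majorization p : (f (cnorm (Xfun p) / 2))%:E <= Yfun p.
Proof.
case: p => u s; rewrite /Xfun /Yfun /Xproc /Yproc /=.
have [[n us]|dead] := pselect (exists n, alive n u s); last first.
  have dead' n : ~~ alive n u s by apply/negP => us; apply: dead; exists n.
  by rewrite !stopped_dead// cnorm0 mul0r; have [_ _ _ -> _] := hf.
rewrite !(stopped_alive _ _ n)//; elim: n u s us => [|n IH] u s /=.
  by move=> /ltW ->.
move=> /andP[/IH sl /IH sr]; case: (leP s (u [::]).2) => [_|_] //.
set a := evaluate odot _ _ _ _ in sl *; set b := evaluate odot _ _ _ _ in sr *.
apply: le_trans (lee_pmul _ _ sl sr); rewrite ?lee_fin ?f_ge0//.
apply: le_trans (f_mul _ _ (half_cnorm_ge0 _) (half_cnorm_ge0 _)).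
apply: (class_S_le hf) => //.
by have := cnorm_odot (u [::]).1 a b; lra.
Qed.

End processes.

(** * Moments of the processes *)

Section first_generation_of_processes.
Context {R : realType} {d : nat} {h : Rd R d -> R} {K : cascade_family R d}.
Hypothesis hK : is_cascade h K.
Variables (chi0 : Rd R d -> 'rV[complex R]_d) (f : R -> R).
Hypotheses (hchi0 : measurable_Cd chi0) (hf : class_S f).
Local Open Scope ereal_scope.
Notation mtree := (@mtree R d).
Notation sample := (@sample R d K).
Notation mean := (@mean R d K).
Notation majorant := (majorant chi0 f).
Notation Y := (Yfun chi0 f).
Notation X := (Xfun chi0).
Notation N := (Nfun chi0).

Lemma Yfun_split (u : mtree) t : positive_times u ->
  Y (u, t) = if ((u [::]).2 < t)%R
    then Y (left_subtree u, t - (u [::]).2)%R * Y (right_subtree u,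
      t - (u [::]).2)%R
    else majorant (u [::]).1.
Proof.
move=> pu; rewrite /Yfun /Yproc /=; case: ltP => ut; last exact: stopped_leaf.
by rewrite [LHS]stopped_node// => _ a; [exact: mul0e|exact: mule0].
Qed.

Lemma Xfun_split (u : mtree) t : positive_times u ->
  X (u, t) = if ((u [::]).2 < t)%R
    then odot (u [::]).1 (X (left_subtree u, t - (u [::]).2)%R)
                         (X (right_subtree u, t - (u [::]).2)%R)
    else chi0 (u [::]).1.
Proof.
move=> pu; rewrite /Xfun /Xproc /=; case: ltP => ut; last exact: stopped_leaf.
by rewrite [LHS]stopped_node// => xi a; [exact: odot0l|exact: odot0r].
Qed.

Lemma measurable_split_before t (g1 g2 : mtree * measurableTypeR R -> \bar R) :
  measurable_fun setT g1 -> measurable_fun setT g2 ->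
  measurable_fun setT (split_before t g1 g2).
Proof.
have mt : measurable_fun setT (fun u : mtree =>
  (t - (u [::]).2)%R : measurableTypeR R).
  by apply: measurable_funB;
    [exact: measurable_cst|exact: measurable_root_time].
move=> mg1 mg2; apply: measurable_fun_ifT => //.
  by apply: measurable_fun_ltr;
    [exact: measurable_root_time|exact: measurable_cst].
apply: emeasurable_funM.
- apply: (measurableT_comp mg1); apply: measurable_fun_pair => //.
  exact: measurable_left_subtree.
- apply: (measurableT_comp mg2); apply: measurable_fun_pair => //.
  exact: measurable_right_subtree.
Qed.

Lemma split_before_ge0 t (g1 g2 : mtree * measurableTypeR R -> \bar R) u :
  (forall p, 0 <= g1 p) -> (forall p, 0 <= g2 p) -> 0 <= split_before t g1 g2 u.
Proof. by move=> g10 g20; rewrite /split_before; case: ifP => // _;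
  exact: mule_ge0. Qed.

Lemma measurable_sampled (g : mtree * measurableTypeR R -> \bar R) eta t :
  measurable_fun setT g -> measurable_fun setT (fun w => g (sample eta w, t)).
Proof.
move=> mg; apply: (measurableT_comp mg); apply: measurable_fun_pair => //.
exact: measurable_sample.
Qed.

Variable xi : Rd R d.
Hypothesis xi0 : xi != 0%R.
Notation P := (cas_P K xi).

Lemma sample_root (w : cas_Omega K xi) : (sample xi w [::]).1 = xi.
Proof. exact: (cas_root hK). Qed.

(** What [Y] contributes when the root has not branched before [t]. *)
Definition unsplit_term t (w : cas_Omega K xi) : \bar R :=
  if ((sample xi w [::]).2 < t)%R then 0 else majorant xi.

Lemma majorant_ge0 eta : 0 <= majorant eta.
Proof. by rewrite lee_fin; have [f0 _ _ _ _] := hf;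
  rewrite f0// divr_ge0 ?cnorm_ge0. Qed.

Lemma measurable_unsplit_term t : measurable_fun setT (unsplit_term t).
Proof.
apply: measurable_fun_ifT => //; apply: measurable_fun_ltr.
  exact: (measurableT_comp measurable_root_time (measurable_sample xi)).
exact: measurable_cst.
Qed.

Lemma mean_Y_split t : mean Y xi t =
  \int[P]_w split_before t Y Y (sample xi w) + \int[P]_w unsplit_term t w.
Proof.
have mY := measurable_Yfun chi0 f hchi0 hf.
have Y0 := Yfun_ge0 chi0 f hf.
have mS : measurable_fun setT (fun w => split_before t Y Y (sample xi w)).
  exact: (measurableT_comp (measurable_split_before t Y Y mY mY)
    (measurable_sample xi)).
have U0 w : 0 <= unsplit_term t w.
  by rewrite /unsplit_term; case: ifP => // _; exact: majorant_ge0.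
have S0 w : 0 <= split_before t Y Y (sample xi w) by exact: split_before_ge0.
rewrite -ge0_integralD//; last exact: measurable_unsplit_term.
apply: ge0_ae_eq_integral => //.
- exact: measurable_sampled.
- by apply: emeasurable_funD => //; exact: measurable_unsplit_term.
- by move=> w _; exact: adde_ge0.
- have := positive_times_ae hK xi xi0; apply: filterS => w pw _.
  rewrite Yfun_split// /split_before /unsplit_term sample_root.
  by case: ifP => _; rewrite ?adde0 ?add0e.
Qed.

Lemma unsplit_term_lty t : \int[P]_w unsplit_term t w < +oo.
Proof.
apply: (@le_lt_trans _ _ (\int[P]_w majorant xi)); last first.
  rewrite integral_cst// [X in _ * X]probability_setT mule1; exact: ltry.
apply: ge0_le_integral => //.
- by move=> w _; rewrite /unsplit_term; case: ifP => // _; exact: majorant_ge0.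
- exact: measurable_unsplit_term.
- by move=> w _; rewrite /unsplit_term; case: ifP => // _; exact: majorant_ge0.
Qed.

Lemma split_Y_lty t : mean Y xi t < +oo ->
  \int[P]_w split_before t Y Y (sample xi w) < +oo.
Proof.
apply: le_lt_trans; rewrite mean_Y_split leeDl// integral_ge0// => w _.
by rewrite /unsplit_term; case: ifP => // _; exact: majorant_ge0.
Qed.

Let f1_gt0 : (0 < f 1)%R. Proof. exact: class_S_gt0. Qed.

Let affine_lty (g : cas_Omega K xi -> \bar R) (c : R) :
  measurable_fun setT g -> (forall w, 0 <= g w) -> (0 <= c)%R ->
  \int[P]_w g w < +oo -> \int[P]_w (c%:E * (1%:E + (f 1)^-1%:E * g w)) < +oo.
Proof.
move=> mg g0 c0 goo.
have if0 : 0 <= (f 1)^-1%:E by rewrite lee_fin invr_ge0 ltW.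
have mfg : measurable_fun setT (fun w => (f 1)^-1%:E * g w)
  by exact: measurable_funeM.
have fg0 w : 0 <= (f 1)^-1%:E * g w by exact: mule_ge0.
rewrite ge0_integralZl//; last 2 first.
- exact: emeasurable_funD.
- by move=> w _; exact: adde_ge0.
rewrite ge0_integralD// integral_cst// [X in 1%:E * X]probability_setT mule1.
rewrite ge0_integralZl// lte_mul_pinfty// lte_add_pinfty ?ltry//.
by rewrite lte_mul_pinfty.
Qed.

(** The bound [x <= 1 + f x / f 1] turns moments of [Y] into moments of [X]. *)
Lemma mean_N_lty t : mean Y xi t < +oo -> mean N xi t < +oo.
Proof.
have mY := measurable_Yfun chi0 f hchi0 hf.
have Y0 := Yfun_ge0 chi0 f hf.
move=> Yoo; have mYs := measurable_sampled Y xi t mY.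
(* The factor 2 undoes the halving of the norm in [majorization]. *)
apply: (le_lt_trans _ (affine_lty _ 2 mYs (fun=> Y0 _) (ler0n _ 2) Yoo)).
apply: ge0_le_integral => //.
- by move=> w _; exact: Nfun_ge0.
- by apply: measurable_sampled; exact: measurable_Nfun.
- apply: measurable_funeM; apply: emeasurable_funD => //.
  by apply: measurable_funeM; exact: measurable_sampled.
move=> w _; rewrite /Nfun.
have c0 : (0 <= cnorm (X (sample xi w, t))
  / 2)%R by rewrite divr_ge0 ?cnorm_ge0.
have := class_S_linear_bound hf _ c0.
move: (majorization chi0 f hf (sample xi w, t)).
move: (cnorm _) (Y _) (Y0 (sample xi w, t)) => c [y||]// _ cy cb; last first.
  by rewrite gt0_muley ?lte_fin ?invr_gt0// addey// gt0_muley ?leey// lte_fin.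
rewrite lee_fin in cy; rewrite -EFinM lee_fin.
have : (f (c / 2) / f 1 <= (f 1)^-1 * y)%R.
  by rewrite mulrC ler_pM2l// invr_gt0.
lra.
Qed.

(** The same bound, for the product over the two subtrees; [f] of the product is
    at most the product of the two values of [Y]. *)
Lemma split_N_lty t : mean Y xi t < +oo ->
  \int[P]_w split_before t N N (sample xi w) < +oo.
Proof.
have mY := measurable_Yfun chi0 f hchi0 hf.
have mN := measurable_Nfun chi0 hchi0.
have Y0 := Yfun_ge0 chi0 f hf.
move=> /split_Y_lty Yoo.
have mS g : measurable_fun setT g ->
    measurable_fun setT (fun w => split_before t g g (sample xi w)).
  move=> mg.
  exact: (measurableT_comp (measurable_split_before t g g mg mg)
    (measurable_sample xi)).
have S0 w : 0 <= split_before t Y Y (sample xi w) by exact: split_before_ge0.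
apply: (le_lt_trans _ (affine_lty _ 4 (mS Y mY) S0 (ler0n _ 4) Yoo)).
apply: ge0_le_integral => //.
- by move=> w _; apply: split_before_ge0 => p; exact: Nfun_ge0.
- exact: mS.
- apply: measurable_funeM; apply: emeasurable_funD => //.
  by apply: measurable_funeM; exact: mS.
move=> w _; rewrite /split_before; case: ifP => _; last first.
  by rewrite mule0 adde0 mule1 lee_fin.
set p := (left_subtree _, _); set q := (right_subtree _, _).
rewrite /Nfun.
have cp : (0 <= cnorm (X p) / 2)%R by rewrite divr_ge0 ?cnorm_ge0.
have cq : (0 <= cnorm (X q) / 2)%R by rewrite divr_ge0 ?cnorm_ge0.
have := class_S_linear_bound hf _ (mulr_ge0 cp cq).
have fM : (f (cnorm (X p) / 2 * (cnorm (X q) / 2)) <=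
   f (cnorm (X p) / 2) * f (cnorm (X q) / 2))%R by have [_ + _ _ _] := hf;
     apply.
have [f0 _ _ _ _] := hf.
have : (f (cnorm (X p) / 2) * f (cnorm (X q) / 2))%:E <= Y p * Y q.
  by rewrite EFinM; apply: lee_pmul; rewrite ?lee_fin ?f0//;
    exact: majorization.
move: (Y p * Y q) (mule_ge0 (Y0 p) (Y0 q)) => [y||]// _ cy cb; last first.
  by rewrite gt0_muley ?lte_fin ?invr_gt0// addey// gt0_muley ?leey// lte_fin.
rewrite lee_fin in cy; rewrite -!EFinM lee_fin.
have : (f (cnorm (X p) / 2 * (cnorm (X q) / 2)) / f 1 <= (f 1)^-1 * y)%R.
  by rewrite mulrC ler_pM2l ?invr_gt0// (le_trans fM).
move: (cnorm (X p)) (cnorm (X q)) cb {fM cy cp cq} => a b; lra.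
Qed.

(** Jensen's inequality, by the support line of [f] at half the mean of [N]. *)
Lemma jensen_N t : mean Y xi t < +oo ->
  (fine (mean N xi t) <= 2 * inv_S f (fine (mean Y xi t)))%R.
Proof.
have mY := measurable_Yfun chi0 f hchi0 hf.
have Y0 := Yfun_ge0 chi0 f hf.
have mN := measurable_Nfun chi0 hchi0.
move=> Yoo; have Noo := mean_N_lty t Yoo.
have N0 : 0 <= mean N xi t by apply: mean_ge0 => p; exact: Nfun_ge0.
have Ym0 : 0 <= mean Y xi t by exact: mean_ge0.
have [y0 yE] : (0 <= fine (mean Y xi t))%R /\ (fine (mean Y xi t))%:E = mean Y
  xi t.
  by split; [exact: fine_ge0|rewrite fineK// ge0_fin_numE].
have [n0 nE] : (0 <= fine (mean N xi t))%R /\ (fine (mean N xi t))%:E = mean N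
  xi t.
  by split; [exact: fine_ge0|rewrite fineK// ge0_fin_numE].
move: (fine (mean N xi t)) (fine (mean Y xi t)) n0 nE y0 yE => n y n0 nE y0 yE.
rewrite -ler_pdivrMl// mulrC; apply: (le_inv_S hf); first by rewrite divr_ge0.
have [->|np] := eqVneq n 0%R; first by rewrite mul0r; have [_ _ _ -> _] := hf.
have z0 : (0 < n / 2)%R by rewrite divr_gt0// lt_neqAle eq_sym np.
have [m m0 sup] := class_S_support hf _ z0.
have f0 : (0 <= f (n / 2))%R by rewrite ltW// class_S_gt0.
suff : (f (n / 2))%:E + (m / 2)%:E * mean N xi t <= mean Y xi t + (m * (n /
  2))%:E.
  by rewrite -nE -yE -EFinM -!EFinD lee_fin; lra.
have intc (c : R) : \int[P]_w c%:E = c%:E.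
  by rewrite integral_cst// [X in _ * X]probability_setT mule1.
have m20 : 0 <= (m / 2)%:E by rewrite lee_fin divr_ge0.
rewrite -[X in X + _]intc -[X in _ <= _ + X]intc.
have mNs : measurable_fun setT (fun w => N (sample xi w, t))
  by exact: measurable_sampled.
have mYs : measurable_fun setT (fun w => Y (sample xi w, t))
  by exact: measurable_sampled.
have Np w : 0 <= N (sample xi w, t) by exact: Nfun_ge0.
rewrite /mean -[X in _ + X <= _]ge0_integralZl//.
rewrite -ge0_integralD//; last 2 first.
- by move=> w _; rewrite mule_ge0.
- exact: measurable_funeM.
rewrite -ge0_integralD//; last first.
  by move=> w _; rewrite lee_fin mulr_ge0// ltW.
apply: ge0_le_integral => //.
- by move=> w _; rewrite adde_ge0// mule_ge0.
- by apply: emeasurable_funD => //; exact: measurable_funeM.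
- exact: emeasurable_funD.
move=> w _; rewrite /Nfun.
have c0 : (0 <= cnorm (X (sample xi w, t))
  / 2)%R by rewrite divr_ge0 ?cnorm_ge0.
apply: (@le_trans _ _ ((f (cnorm (X (sample xi w, t))
  / 2))%:E + (m * (n / 2))%:E)).
  rewrite -EFinM -!EFinD lee_fin; have := sup _ c0; lra.
by rewrite leeD2r//; exact: majorization.
Qed.

End first_generation_of_processes.

(** * Branching for signed functionals *)

Section signed_integrals.
Local Open Scope ereal_scope.

Lemma integral_difference d (T : measurableType d) (R : realType)
    (m : {measure set T -> \bar R}) (u v F : T -> \bar R) :
  measurable_fun setT u -> measurable_fun setT v -> measurable_fun setT F ->
  (forall x, 0 <= u x) -> (forall x, 0 <= v x) ->
  \int[m]_x u x < +oo -> \int[m]_x v x < +oo ->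
  {ae m, forall x, F x = u x - v x} ->
  m.-integrable setT F /\ \int[m]_x F x = \int[m]_x u x - \int[m]_x v x.
Proof.
move=> mu mv mF u0 v0 uoo voo Fuv.
have iu : m.-integrable setT u.
  by apply/integrableP; split => //; under eq_integral do rewrite gee0_abs//.
have iv : m.-integrable setT v.
  by apply/integrableP; split => //; under eq_integral do rewrite gee0_abs//.
have Fuv' : ae_eq m setT F (u \- v) by apply: filterS Fuv => x Fx _.
split; last first.
  rewrite -integralB//; apply: ae_eq_integral => //.
  exact: measurable_int (integrableB measurableT iu iv).
have := integrableB measurableT iu iv => /integrableP[muv uvoo].
apply/integrableP; split => //.
rewrite (ae_eq_integral (fun x => `|(u \- v) x|))//.
- exact: measurableT_comp.
- exact: measurableT_comp.
- by apply: filterS Fuv' => x /= + _; move=> ->.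
Qed.

(** An infinite factor is harmless: the product is finite only if the other
    factor has vanishing positive and negative parts. *)
Lemma fine_mulB (R : realType) (x y u v : \bar R) :
  0 <= x -> 0 <= y -> 0 <= u -> 0 <= v -> (x + y) * (u + v) < +oo ->
  (fine (x - y) * fine (u - v))%:E = (x * u + y * v) - (x * v + y * u).
Proof.
have H (a b c e : \bar R) : 0 <= a -> 0 <= b -> 0 <= c -> 0 <= e ->
    a + b = +oo -> (a + b) * (c + e) < +oo -> c = 0 /\ e = 0.
  move=> _ _ c0 e0 ->; have [uv0|uv0] := eqVneq (c + e) 0.
    by move: uv0 => /eqP; rewrite padde_eq0// => /andP[/eqP -> /eqP ->].
  by rewrite gt0_mulye ?ltxx// lt_neqAle eq_sym uv0 adde_ge0.
move=> x0 y0 u0 v0 xyuv.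
have [xyoo|xyoo] := eqVneq (x + y) +oo.
  have [-> ->] := H _ _ _ _ x0 y0 u0 v0 xyoo xyuv.
  by rewrite !mule0 adde0 sube0 /= mulr0.
have [uvoo|uvoo] := eqVneq (u + v) +oo.
  rewrite muleC in xyuv; have [-> ->] := H _ _ _ _ u0 v0 x0 y0 uvoo xyuv.
  by rewrite !mul0e adde0 sube0 /= mul0r.
clear H xyuv; move: x0 y0 u0 v0 xyoo uvoo.
case: x => [x||]; case: y => [y||]; case: u => [u||]; case: v => [v||] // *.
by rewrite /= -!EFinM -!EFinD; congr EFin; ring.
Qed.

End signed_integrals.

Section cascade_equations.
Context {R : realType} {d : nat} {h : Rd R d -> R} {K : cascade_family R d}.
Hypothesis hK : is_cascade h K.
Local Open Scope ereal_scope.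
Notation mtree := (@mtree R d).
Notation sample := (@sample R d K).
Notation mean := (@mean R d K).
Variable xi : Rd R d.
Hypothesis xi0 : xi != 0%R.
Notation P := (cas_P K xi).
Notation time_law := (@time_law R d K xi).
Notation child_law := (@child_law R d K xi).
Notation mean_product := (@mean_product R d K xi).
Notation rate := (enorm xi ^+ 2)%R.
Notation mu1 := (@lebesgue_measure R).

(** The inner integral of the equations, at time [r]. *)
Definition child_integral (g1 g2 : mtree * measurableTypeR R -> \bar R) (r : R)
  :=
  \int[child_law]_eta (mean g1 eta r * mean g2 (xi - eta)%R r).

Section nonnegative.
Variables g1 g2 : mtree * measurableTypeR R -> \bar R.
Hypotheses (mg1 : measurable_fun setT g1) (mg2 : measurable_fun setT g2).
Hypotheses (g10 : forall p, 0 <= g1 p) (g20 : forall p, 0 <= g2 p).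

Lemma measurable_child_integral :
  measurable_fun setT (child_integral g1 g2 : measurableTypeR R -> \bar R).
Proof.
apply: (@measurable_fun_fubini_tonelli_F _ _ _ _ R child_law
  (fun z : measurableTypeR R * Rd R d =>
    mean g1 z.2 z.1 * mean g2 (xi - z.2)%R z.1)).
  apply: emeasurable_funM.
    pose s (z : measurableTypeR R * Rd R d) : Rd R d * measurableTypeR R :=
      (z.2, z.1).
    have ms : measurable_fun setT s by exact: measurable_fun_pair.
    exact: (measurableT_comp (measurable_mean hK g1 mg1 g10) ms).
  pose s (z : measurableTypeR R * Rd R d) : Rd R d * measurableTypeR R :=
    ((xi - z.2)%R, z.1).
  have ms : measurable_fun setT s.
    apply: measurable_fun_pair => //.
    by apply: measurable_subRd => //; exact: measurable_cst.
  exact: (measurableT_comp (measurable_mean hK g2 mg2 g20) ms).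
by move=> z; apply: mule_ge0; exact: mean_ge0.
Qed.

Lemma mean_product_time t :
  \int[giry_prod (time_law, child_law)]_z mean_product t g1 g2 z =
  \int[time_law]_s (if (s < t)%R then child_integral g1 g2 (t - s)%R else 0).
Proof.
have mp0 z : 0 <= mean_product t g1 g2 z.
  by rewrite /mean_product; case: ifP => // _; apply: mule_ge0; exact: mean_ge0.
have mmp := measurable_mean_product hK xi t g1 g2 mg1 mg2 g10 g20.
transitivity (giry_int (giry_prod (time_law, child_law)) (mean_product t g1 g2))
  => //.
rewrite giry_int_prod1//; apply: eq_integral => s _.
rewrite /mean_product /=; case: ifP => // _.
exact: integral0.
Qed.

Lemma measurable_child_integral_before t : measurable_fun setT
  (fun s : R => if (s < t)%R then child_integral g1 g2 (t - s)%R else 0).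
Proof.
apply: measurable_fun_ifT => //.
  by apply: measurable_fun_ltr => //; exact: measurable_cst.
have mt : measurable_fun setT (fun s : R => t - s : measurableTypeR R)%R.
  exact: (measurable_funB (measurable_cst t) (@measurable_id _ R setT)).
exact: (measurableT_comp measurable_child_integral mt).
Qed.

(** By the lack of memory of the exponential law, delaying the first branching
    by [t' - t] costs at most the factor [exp (rate * (t' - t))]. *)
Lemma mean_product_lty_le t t' : (t <= t')%R ->
  \int[giry_prod (time_law, child_law)]_z mean_product t' g1 g2 z < +oo ->
  \int[giry_prod (time_law, child_law)]_z mean_product t g1 g2 z < +oo.
Proof.
move=> tt'.
have q0 r : 0 <= child_integral g1 g2 r.
  by apply: integral_ge0 => eta _; apply: mule_ge0; exact: mean_ge0.
(* The translation by [t' - t] below compares this integrand at [t] and [t']. *)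
pose G t s := (exponential_pdf rate s)%:E *
  (if (s < t)%R then child_integral g1 g2 (t - s)%R else 0).
have JE t0 : \int[giry_prod (time_law, child_law)]_z mean_product t0 g1 g2 z =
    \int[mu1]_s G t0 s.
  apply: (eq_trans (mean_product_time t0)).
  exact: (integral_time_law hK xi xi0 _ (measurable_child_integral_before t0)).
have r0 := rate_gt0 xi xi0.
have p0 s : (0 <= exponential_pdf rate s)%R by rewrite exponential_pdf_ge0//
  ltW.
have G0 t0 s : 0 <= G t0 s.
  by rewrite mule_ge0 ?lee_fin//; case: ifP.
have mG t0 : measurable_fun setT (G t0).
  apply: emeasurable_funM; last exact: measurable_child_integral_before.
  by apply/measurable_EFinP; exact: measurable_exponential_pdf.
have Gle s : G t s <= (expR (rate * (t' - t)))%:E * G t' (s - (t - t'))%R.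
  rewrite /G muleA -EFinM.
  have -> : (s - (t - t') < t')%R = (s < t)%R by apply/idP/idP; lra.
  have -> : (t' - (s - (t - t')) = t - s)%R by ring.
  apply: lee_wpmul2r; first by case: ifP.
  rewrite lee_fin; have [s0|s0] := leP 0%R s; last first.
    by rewrite lt0_exponential_pdf// mulr_ge0// expR_ge0.
  rewrite !exponential_pdfE//; last lra.
  rewrite mulrCA -expRD le_eqVlt; apply/orP; left; apply/eqP.
  by congr (_ * expR _)%R; ring.
rewrite (JE t) (JE t'); clearbody G => {JE}.
have mt : measurable_fun setT (fun s : R => s - (t - t'))%R.
  exact: (measurable_funB (@measurable_id _ R setT) (measurable_cst _)).
have mGt : measurable_fun setT (fun s : R => G t' (s - (t - t'))%R).
  exact: (measurableT_comp (mG t') mt).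
rewrite -(ge0_integral_translation (t - t') (G t') (mG t') (G0 t')) => Goo.
apply: (@le_lt_trans _ _ (\int[mu1]_s ((expR (rate * (t' - t)))%:E * G t' (s -
  (t - t'))%R))).
  by apply: ge0_le_integral => //;
    [exact: (mG t)|exact: (measurable_funeM _ mGt)].
rewrite ge0_integralZl//.
by rewrite lte_mul_pinfty// lee_fin expR_ge0.
Qed.

End nonnegative.

Section signed.
Implicit Types a b : mtree * measurableTypeR R -> R.

Lemma max0_subE (c : R) : (Num.max c 0 - Num.max (- c) 0 = c)%R.
Proof.
have [c0|] := boolP (0 <= c)%R.
  by rewrite (max_l c0) max_r ?oppr_le0// subr0.
rewrite -ltNge => /ltW c0; rewrite (max_r c0) max_l ?oppr_ge0//.
by rewrite sub0r opprK.
Qed.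

Definition smean a (eta : Rd R d) (r : R) :=
  \int[cas_P K eta]_w (a (sample eta w, r))%:E.

Definition pos_part a p : \bar R := (Num.max (a p) 0%R)%:E.
Definition neg_part a p : \bar R := (Num.max (- a p)%R 0%R)%:E.
Definition abs_part a p : \bar R := (`|a p|)%:E.

Lemma pos_part_ge0 a p : 0 <= pos_part a p.
Proof. by rewrite lee_fin le_max lexx orbT. Qed.

Lemma neg_part_ge0 a p : 0 <= neg_part a p.
Proof. by rewrite lee_fin le_max lexx orbT. Qed.

Lemma measurable_pos_part a : measurable_fun setT a ->
  measurable_fun setT (pos_part a).
Proof.
by move=> ma; apply/measurable_EFinP; apply: measurable_maxr => //;
  exact: measurable_cst.
Qed.

Lemma measurable_neg_part a : measurable_fun setT a ->
  measurable_fun setT (neg_part a).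
Proof.
move=> ma; apply/measurable_EFinP; apply: measurable_maxr;
  last exact: measurable_cst.
exact: measurable_funN.
Qed.

Lemma abs_partE a p : abs_part a p = pos_part a p + neg_part a p.
Proof.
rewrite /abs_part /pos_part /neg_part -EFinD; congr EFin.
have [a0|] := boolP (0 <= a p)%R.
  by rewrite ger0_norm// max_l// max_r ?oppr_le0// addr0.
rewrite -ltNge => a0; rewrite ltr0_norm// max_r ?(ltW a0)//.
by rewrite max_l ?oppr_ge0 ?(ltW a0)// add0r.
Qed.

Lemma smeanE a eta r :
  smean a eta r = mean (pos_part a) eta r - mean (neg_part a) eta r.
Proof.
by rewrite /smean integralE; congr (_ - _); apply: eq_integral => w _;
  rewrite ?funeposE ?funenegE /pos_part /neg_part EFin_max.
Qed.

Lemma measurable_smean a : measurable_fun setT a ->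
  measurable_fun setT (fun p : Rd R d * measurableTypeR R =>
    fine (smean a p.1 p.2)).
Proof.
move=> ma; apply: (measurableT_comp (fine_measurable measurableT)).
under eq_fun do rewrite smeanE.
apply: emeasurable_funB; apply: (measurable_mean hK).
- exact: measurable_pos_part.
- exact: pos_part_ge0.
- exact: measurable_neg_part.
- exact: neg_part_ge0.
Qed.

Definition smean_product t a b (z : measurableTypeR R * Rd R d) : R :=
  if (z.1 < t)%R
  then (fine (smean a z.2 (t - z.1)) * fine (smean b (xi - z.2) (t - z.1)))%R
  else 0%R.

Definition ssplit t a b (u : mtree) : R :=
  if ((u [::]).2 < t)%R
  then (a (left_subtree u, t - (u [::]).2) * b (right_subtree u,
    t - (u [::]).2))%R
  else 0%R.

Notation tau_q := (giry_prod (time_law, child_law)).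

(* The positive and the negative part of a product of differences. *)
Let plus t a b u := split_before t (pos_part a) (pos_part b) u +
                    split_before t (neg_part a) (neg_part b) u.
Let minus t a b u := split_before t (pos_part a) (neg_part b) u +
                     split_before t (neg_part a) (pos_part b) u.
Let mplus t a b z := mean_product t (pos_part a) (pos_part b) z +
                     mean_product t (neg_part a) (neg_part b) z.
Let mminus t a b z := mean_product t (pos_part a) (neg_part b) z +
                      mean_product t (neg_part a) (pos_part b) z.

Let split_ge0 t (g1 g2 : mtree * measurableTypeR R -> \bar R) u :
  (forall p, 0 <= g1 p) -> (forall p, 0 <= g2 p) -> 0 <= split_before t g1 g2 u.
Proof. exact: split_before_ge0. Qed.

Let mean_product_ge0 t (g1 g2 : mtree * measurableTypeR R -> \bar R) z :
  (forall p, 0 <= g1 p) -> (forall p, 0 <= g2 p) -> 0 <= mean_product t g1 g2 z.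
Proof.
by move=> g10 g20; rewrite /mean_product; case: ifP => // _; apply: mule_ge0;
  exact: mean_ge0.
Qed.

Let measurable_split_sampled t (g1 g2 : mtree * measurableTypeR R -> \bar R) :
  measurable_fun setT g1 -> measurable_fun setT g2 ->
  measurable_fun setT (fun w => split_before t g1 g2 (sample xi w)).
Proof.
move=> mg1 mg2.
exact: (measurableT_comp (measurable_split_before t g1 g2 mg1 mg2)
  (measurable_sample xi)).
Qed.

Lemma measurable_smean_product t a b :
  measurable_fun setT a -> measurable_fun setT b ->
  measurable_fun setT (smean_product t a b).
Proof.
move=> ma mb; apply: measurable_fun_ifT => //.
  by apply: measurable_fun_ltr => //; exact: measurable_cst.
have mt : measurable_fun setT
    (fun z : measurableTypeR R * Rd R d => t - z.1 : measurableTypeR R)%R.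
  by apply: measurable_funB => //; exact: measurable_cst.
apply: measurable_funM.
- pose s (z : measurableTypeR R * Rd R d) : Rd R d * measurableTypeR R := (z.2,
  t - z.1)%R.
  have ms : measurable_fun setT s by exact: measurable_fun_pair.
  exact: (measurableT_comp (measurable_smean a ma) ms).
- pose s (z : measurableTypeR R * Rd R d) : Rd R d * measurableTypeR R :=
  (xi - z.2, t - z.1)%R.
  have ms : measurable_fun setT s.
    apply: measurable_fun_pair => //.
    by apply: measurable_subRd => //; exact: measurable_cst.
  exact: (measurableT_comp (measurable_smean b mb) ms).
Qed.

Lemma measurable_ssplit t a b :
  measurable_fun setT a -> measurable_fun setT b ->
  measurable_fun setT (fun w => ssplit t a b (sample xi w)).
Proof.
move=> ma mb; apply: (measurableT_comp _ (measurable_sample xi)).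
have mt : measurable_fun setT (fun u : mtree =>
  (t - (u [::]).2)%R : measurableTypeR R).
  by apply: measurable_funB;
    [exact: measurable_cst|exact: measurable_root_time].
apply: measurable_fun_ifT => //.
  by apply: measurable_fun_ltr;
    [exact: measurable_root_time|exact: measurable_cst].
apply: measurable_funM.
- apply: (measurableT_comp ma); apply: measurable_fun_pair => //.
  exact: measurable_left_subtree.
- apply: (measurableT_comp mb); apply: measurable_fun_pair => //.
  exact: measurable_right_subtree.
Qed.

Let branching_sum t (g1 g2 g3 g4 : mtree * measurableTypeR R -> \bar R) :
  measurable_fun setT g1 -> measurable_fun setT g2 ->
  measurable_fun setT g3 -> measurable_fun setT g4 ->
  (forall p, 0 <= g1 p) -> (forall p, 0 <= g2 p) ->
  (forall p, 0 <= g3 p) -> (forall p, 0 <= g4 p) ->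
  \int[P]_w (split_before t g1 g2 (sample xi w)
    + split_before t g3 g4 (sample xi w)) =
  \int[tau_q]_z (mean_product t g1 g2 z + mean_product t g3 g4 z).
Proof.
move=> mg1 mg2 mg3 mg4 g10 g20 g30 g40.
rewrite [LHS]ge0_integralD//; last 4 first.
- by move=> w _; exact: split_ge0.
- exact: measurable_split_sampled.
- by move=> w _; exact: split_ge0.
- exact: measurable_split_sampled.
rewrite [RHS]ge0_integralD//; last 4 first.
- by move=> w _; exact: mean_product_ge0.
- exact: (measurable_mean_product hK).
- by move=> w _; exact: mean_product_ge0.
- exact: (measurable_mean_product hK).
by congr (_ + _); exact: (mean_branching hK xi xi0).
Qed.

(** Split each factor into its positive and negative part and apply
    [mean_branching] to the four products. *)
Lemma signed_branching t a b :
  measurable_fun setT a -> measurable_fun setT b ->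
  \int[P]_w split_before t (abs_part a) (abs_part b) (sample xi w) < +oo ->
  [/\ P.-integrable setT (fun w => (ssplit t a b (sample xi w))%:E),
      tau_q.-integrable setT (fun z => (smean_product t a b z)%:E) &
      \int[P]_w (ssplit t a b (sample xi w))%:E =
      \int[tau_q]_z (smean_product t a b z)%:E].
Proof.
move=> ma mb abs_lty.
have [mpa mna] := (measurable_pos_part a ma, measurable_neg_part a ma).
have [mpb mnb] := (measurable_pos_part b mb, measurable_neg_part b mb).
have [pa0 na0] := (pos_part_ge0 a, neg_part_ge0 a).
have [pb0 nb0] := (pos_part_ge0 b, neg_part_ge0 b).
have mabs c : measurable_fun setT c -> measurable_fun setT (abs_part c).
  by move=> mc; apply/measurable_EFinP; exact: measurableT_comp.
have abs0 c p : 0 <= abs_part c p by rewrite lee_fin.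
have absE u : split_before t (abs_part a) (abs_part b)
  u = plus t a b u + minus t a b u.
  rewrite /plus /minus /split_before; case: ifP => _; last by rewrite !adde0.
  by rewrite !abs_partE /pos_part /neg_part -!EFinM -!EFinD; congr EFin; ring.
have plus0 u : 0 <= plus t a b u by rewrite adde_ge0// split_ge0.
have minus0 u : 0 <= minus t a b u by rewrite adde_ge0// split_ge0.
have mplus0 z : 0 <= mplus t a b z by rewrite adde_ge0// mean_product_ge0.
have mminus0 z : 0 <= mminus t a b z by rewrite adde_ge0// mean_product_ge0.
have m_plus : measurable_fun setT (fun w => plus t a b (sample xi w)).
  by apply: emeasurable_funD; exact: measurable_split_sampled.
have m_minus : measurable_fun setT (fun w => minus t a b (sample xi w)).
  by apply: emeasurable_funD; exact: measurable_split_sampled.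
have m_mplus : measurable_fun setT (mplus t a b).
  by apply: emeasurable_funD; exact: (measurable_mean_product hK).
have m_mminus : measurable_fun setT (mminus t a b).
  by apply: emeasurable_funD; exact: (measurable_mean_product hK).
have plusE : \int[P]_w plus t a b (sample xi w) = \int[tau_q]_z mplus t a b z.
  exact: branching_sum.
have minusE : \int[P]_w minus t a b (sample xi w)
  = \int[tau_q]_z mminus t a b z.
  exact: branching_sum.
have sum_lty : \int[P]_w plus t a b (sample xi w)
  + \int[P]_w minus t a b (sample xi w) < +oo.
  rewrite -ge0_integralD//; apply: le_lt_trans abs_lty.
  by under eq_integral do rewrite -absE.
have plus_lty : \int[P]_w plus t a b (sample xi w) < +oo.
  by apply: le_lt_trans sum_lty; rewrite leeDl// integral_ge0.
have minus_lty : \int[P]_w minus t a b (sample xi w) < +oo.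
  by apply: le_lt_trans sum_lty; rewrite leeDr// integral_ge0.
have [iP EP] : P.-integrable setT (fun w => (ssplit t a b (sample xi w))%:E) /\
    \int[P]_w (ssplit t a b (sample xi w))%:E =
    \int[P]_w plus t a b (sample xi w) - \int[P]_w minus t a b (sample xi w).
  apply: integral_difference => //.
    by apply/measurable_EFinP; exact: measurable_ssplit.
  apply: aeW => w; rewrite /plus /minus /ssplit /split_before.
  case: ifP => _; last by rewrite !adde0 sube0.
  rewrite /pos_part /neg_part -!EFinM -!EFinD; congr EFin.
  set p := (left_subtree _, _); set q := (right_subtree _, _).
  by rewrite -[in LHS](max0_subE (a p)) -[in LHS](max0_subE (b q)); ring.
have [iQ EQ] : tau_q.-integrable setT (fun z => (smean_product t a b z)%:E) /\
    \int[tau_q]_z (smean_product t a b z)%:E =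
    \int[tau_q]_z mplus t a b z - \int[tau_q]_z mminus t a b z.
  apply: integral_difference => //.
  - by apply/measurable_EFinP; exact: measurable_smean_product.
  - by rewrite -plusE.
  - by rewrite -minusE.
  have m_abs := measurable_mean_product hK xi t _ _ (mabs a ma) (mabs b mb)
    (abs0 a) (abs0 b).
  have : tau_q.-integrable setT (mean_product t (abs_part a) (abs_part b)).
    apply/integrableP; split => //.
    under eq_integral do rewrite gee0_abs ?mean_product_ge0//.
    by rewrite -(mean_branching hK xi xi0 t _ _ (mabs a ma) (mabs b mb) (abs0 a)
      (abs0 b)).
  move=> /integrable_ae -/(_ measurableT); apply: filterS => z /(_ I).
  rewrite ge0_fin_numE ?mean_product_ge0//.
  rewrite /mplus /mminus /smean_product /mean_product.
  case: ifP => _; last by rewrite !adde0 sube0.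
  have meanabs c eta r : measurable_fun setT c ->
      mean (abs_part c) eta r = mean (pos_part c) eta r + mean (neg_part c)
        eta r.
    move=> mc; rewrite /mean -ge0_integralD//.
    - by apply: eq_integral => w _; rewrite abs_partE.
    - by move=> w _; exact: pos_part_ge0.
    - by apply: measurable_sampled; exact: measurable_pos_part.
    - by move=> w _; exact: neg_part_ge0.
    - by apply: measurable_sampled; exact: measurable_neg_part.
  rewrite !meanabs// !smeanE; apply: fine_mulB; exact: mean_ge0.
by split => //; rewrite EP EQ plusE minusE.
Qed.

End signed.

End cascade_equations.

(** * The integral equation *)

Section linear_combinations.
Context d (T : measurableType d) (R : realType) (m : {measure set T -> \bar R}).
Context {I : finType}.
Variables (c : I -> R) (g : I -> T -> R).
Hypothesis ig : forall i, m.-integrable setT (EFin \o g i).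

Let lincomb (s : seq I) x := \sum_(i <- s) c i * g i x.

Let lincomb_seq s : m.-integrable setT (EFin \o lincomb s) /\
  (\int[m]_x lincomb s x = \sum_(i <- s) c i * \int[m]_x g i x).
Proof.
elim: s => [|i s [IHi IHE]].
  have -> : lincomb [::] = cst 0 by apply/funext => x; rewrite /lincomb big_nil.
  by split; [exact: integrable0|rewrite Rintegral_cst// mul0r big_nil].
have E : lincomb (i :: s) = (fun x => c i * g i x + lincomb s x).
  by apply/funext => x; rewrite /lincomb big_cons.
have iZ : m.-integrable setT (EFin \o (fun x => c i * g i x)).
  exact: integrableZl measurableT (c i) _ (ig i).
rewrite E; split.
  by apply: eq_integrable (integrableD measurableT iZ IHi).
by rewrite RintegralD// RintegralZl// IHE big_cons.
Qed.

Lemma integrable_lincomb :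
  m.-integrable setT (fun x => (\sum_i c i * g i x)%:E).
Proof. by have [] := lincomb_seq (index_enum I). Qed.

Lemma Rintegral_lincomb :
  \int[m]_x (\sum_i c i * g i x) = \sum_i c i * \int[m]_x g i x.
Proof. by have [] := lincomb_seq (index_enum I). Qed.

End linear_combinations.

Section first_generation_densities.
Context {R : realType} {d : nat} {h : Rd R d -> R} {K : cascade_family R d}.
Hypothesis d_gt0 : (0 < d)%N.
Hypothesis hK : is_cascade h K.
Hypothesis hh : standard_majorizing_kernel h.
Local Open Scope ereal_scope.
Variable xi : Rd R d.
Hypothesis xi0 : xi != 0%R.
Notation time_law := (@time_law R d K xi).
Notation child_law := (@child_law R d K xi).
Notation tau_q := (giry_prod (time_law, child_law)).
Notation rate := (enorm xi ^+ 2)%R.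
Notation mu1 := (@lebesgue_measure R).

Definition decay (s : R) : R := (expR (- s * rate) * rate)%R.

Lemma decay_ge0 s : (0 <= decay s)%R.
Proof. by rewrite mulr_ge0 ?expR_ge0// ltW// rate_gt0. Qed.

Lemma measurable_decay : measurable_fun setT decay.
Proof.
apply: measurable_funM => //; apply: (measurableT_comp (@measurable_expR R)).
by apply: measurable_funM => //; exact: measurable_funN.
Qed.

Lemma time_integral t (g : R -> \bar R) : measurable_fun setT g ->
  \int[time_law]_s (if (s < t)%R then g s else 0) =
  \int[mu1]_(s in `[0%R, t]) ((decay s)%:E * g s).
Proof.
move=> mg.
have mgt : measurable_fun setT (fun s : R => if (s < t)%R then g s else 0).
  apply: measurable_fun_ifT => //.
  exact: (measurable_fun_ltr (@measurable_id _ R setT) (measurable_cst t)).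
rewrite (integral_time_law hK xi xi0 _ mgt).
rewrite -integral_itv_bndo_bndc; last first.
  apply: measurable_funTS; apply: emeasurable_funM => //.
  by apply/measurable_EFinP; exact: measurable_decay.
rewrite [RHS]integral_mkcond; apply: eq_integral => s _; rewrite patchE.
rewrite (_ : (s \in _) = (0 <= s < t)%R); last first.
  by apply/idP/idP; rewrite inE/= in_itv.
have [s0|s0] := leP 0%R s; last by rewrite lt0_exponential_pdf// mul0e.
case: ifPn => [st|_] /=; last by rewrite mule0.
rewrite exponential_pdfE//.
by congr (_%:E * _); rewrite /decay mulrC; congr (expR _ * _)%R; ring.
Qed.

Lemma survival t : (0 <= t)%R ->
  cas_P K xi [set w | (t <= cas_T K xi [::] w)%R] = (expR (- t * rate))%:E.
Proof.
move=> t0; have -> : [set w | (t <= cas_T K xi [::] w)%R] =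
    ~` (cas_T K xi [::] @^-1` `]-oo, t[%classic).
  apply/seteqP; split=> w /=; rewrite in_itv/= leNgt; first by move=> /negP.
  by move=> /negP.
have mI : measurable (cas_T K xi [::] @^-1` `]-oo, t[%classic).
  by rewrite -[X in measurable X]setTI; exact: measurable_cas_T.
rewrite probability_setC//.
have -> : cas_P K xi (cas_T K xi [::] @^-1` `]-oo, t[%classic) =
    exponential_prob rate `[0%R, t].
  transitivity (time_law `]-oo, t[%classic) => //.
  rewrite (time_lawE hK xi xi0)// integral_itv_bndo_bndc; last first.
    apply: measurable_funTS; apply/measurable_EFinP.
    exact: measurable_exponential_pdf.
  rewrite /exponential_prob integral_mkcond [RHS]integral_mkcond.
  apply: eq_integral => s _; rewrite !patchE.
  have [s0|s0] := leP 0%R s; last by rewrite lt0_exponential_pdf//; case: ifP;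
    case: ifP.
  congr (if _ then _ else _); apply/idP/idP; rewrite !inE/= !in_itv/= s0//.
move: t0; rewrite le_eqVlt => /predU1P[<-|t0]; last first.
  rewrite exponential_prob_itv0c// oppeB ?fin_num_adde_defl// addeA subee//
    add0e.
  by congr (expR _)%:E; ring.
by rewrite set_itv1 /exponential_prob integral_set1 sube0 oppr0 mul0r expR0.
Qed.

(** Integration against the law of the first step, in the coordinates of the
    integral equation. *)
Lemma ge0_first_step_integral t (F : R -> Rd R d -> R) :
  measurable_fun setT (fun z : measurableTypeR R * Rd R d => F z.1 z.2) ->
  (forall s eta, 0 <= F s eta)%R ->
  \int[tau_q]_z (if z.1 < t then F z.1 z.2 else 0)%R%:E =
  \int[mu1]_(s in `[0%R, t])
    \int[leb d]_eta (decay s * (F s eta * Hker h eta xi))%:E.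
Proof.
move=> mF F0.
have mFt : measurable_fun setT
    (fun z : measurableTypeR R * Rd R d =>
      (if z.1 < t then F z.1 z.2 else 0)%R%:E).
  apply/measurable_EFinP; apply: measurable_fun_ifT => //;
    exact: measurable_before.
have F0' (z : measurableTypeR R * Rd R d)
  : 0 <= (if z.1 < t then F z.1 z.2 else 0)%R%:E.
  by rewrite lee_fin; case: ifP.
have mFs s : measurable_fun setT (F s).
  exact: (measurableT_comp mF (measurable_fun_pair (measurable_cst s)
    (@measurable_id _ _ setT))).
transitivity (giry_int tau_q
    (fun z : measurableTypeR R * Rd R d =>
      (if z.1 < t then F z.1 z.2 else 0)%R%:E)) => //.
rewrite giry_int_prod1//.
pose G s := \int[child_law]_eta (F s eta)%:E.
have mG : measurable_fun setT (G : measurableTypeR R -> \bar R).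
  apply: (@measurable_fun_fubini_tonelli_F _ _ _ _ R child_law
    (fun z : measurableTypeR R * Rd R d => (F z.1 z.2)%:E)).
    exact/measurable_EFinP.
  by move=> z; rewrite lee_fin.
transitivity (\int[time_law]_s (if (s < t)%R then G s else 0)).
  by apply: eq_integral => s _ /=; case: ifP => // _; exact: integral0.
rewrite (time_integral t G mG); apply: eq_integral => s _.
rewrite -ge0_integralZl//; last 3 first.
- exact/measurable_EFinP.
- by move=> eta _; rewrite lee_fin.
- by rewrite lee_fin decay_ge0.
have mZ : measurable_fun setT (fun eta => (decay s)%:E * (F s eta)%:E).
  by apply: measurable_funeM; exact/measurable_EFinP.
rewrite (integral_child_law hK hh xi xi0 _ d_gt0 mZ).
by apply: eq_integral => eta _; rewrite -!EFinM; congr EFin; ring.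
Qed.

(** Fubini's theorem gives a finite inner integral for almost every time only,
    which is enough for the real-valued outer integral. *)
Lemma Rintegral_first_step t (F : R -> Rd R d -> R) :
  measurable_fun setT (fun z : measurableTypeR R * Rd R d => F z.1 z.2) ->
  tau_q.-integrable setT
    (fun z : measurableTypeR R * Rd R d =>
      (if z.1 < t then F z.1 z.2 else 0)%R%:E) ->
  (\int[tau_q]_z (if z.1 < t then F z.1 z.2 else 0) =
   \int[mu1]_(s in `[0, t])
     (decay s * \int[leb d]_eta (Hker h eta xi * F s eta)))%R.
Proof.
move=> mF iF.
have mFs s : measurable_fun setT (F s).
  exact: (measurableT_comp mF (measurable_fun_pair (measurable_cst s)
    (@measurable_id _ _ setT))).
have mE s : measurable_fun setT (fun eta => (F s eta)%:E)
  by exact/measurable_EFinP.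
pose G s := fine (\int[child_law]_eta (F s eta)%:E).
have mG : measurable_fun setT (G : R -> R).
  apply: (measurableT_comp (fine_measurable measurableT)).
  under eq_fun do rewrite integralE.
  have mpart (k : R -> R) : measurable_fun setT k -> (forall x, 0 <= k x)%R ->
      measurable_fun setT (fun s : measurableTypeR R =>
        \int[child_law]_eta (k (F s eta))%:E).
    move=> mk k0; apply: (@measurable_fun_fubini_tonelli_F _ _ _ _ R child_law
      (fun z : measurableTypeR R * Rd R d => (k (F z.1 z.2))%:E)).
      by apply/measurable_EFinP; exact: (measurableT_comp mk mF).
    by move=> z; rewrite lee_fin.
  have max_ge0 x : (0 <= Num.max x 0 :> R)%R by rewrite le_max lexx orbT.
  have mmax (k : R -> R) : measurable_fun setT k ->
      measurable_fun setT (fun x => Num.max (k x) 0)%R.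
    by move=> mk; apply: measurable_maxr => //; exact: measurable_cst.
  apply: emeasurable_funB.
  - apply: eq_measurable_fun (mpart (fun x => Num.max x 0)%R
      (mmax _ (@measurable_id _ R setT)) max_ge0) => s _.
    by apply: eq_integral => eta _; rewrite funeposE EFin_max.
  - apply: eq_measurable_fun (mpart (fun x => Num.max (- x) 0)%R
      (mmax _ (measurable_funN (@measurable_id _ R setT))) (fun x =>
        max_ge0 (- x)%R)) => s _.
    by apply: eq_integral => eta _; rewrite funenegE EFin_max.
pose Ft (z : measurableTypeR R * Rd R d) : \bar R :=
  (if z.1 < t then F z.1 z.2 else 0)%R%:E.
pose A s := \int[child_law]_eta Ft (s, eta).
have AE : \int[time_law]_s A s = \int[tau_q]_z Ft z.
  exact: (integral12_prod_meas1 iF).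
have mA : measurable_fun setT (A : measurableTypeR R -> \bar R).
  exact: measurable_int (integrable_fubini_F iF).
have AG : ae_eq time_law setT A (fun s => if (s < t)%R then (G s)%:E else 0).
  have : {ae time_law, forall s, child_law.-integrable setT (fun eta => Ft (s,
    eta))}.
    exact: (ae_integrable1 iF).
  apply: filterS => s iFs _; rewrite /A /Ft /=.
  have := iFs; rewrite /Ft /=; case: ifP => st iFs'; last exact: integral0.
  by rewrite /G fineK//; exact: (integrable_fin_num measurableT iFs').
have mGt : measurable_fun setT (fun s : R => if (s < t)%R then (G s)%:E else 0).
  apply: measurable_fun_ifT => //; last exact/measurable_EFinP.
  exact: (measurable_fun_ltr (@measurable_id _ R setT) (measurable_cst t)).
rewrite /Rintegral -/Ft; congr fine.
apply: (eq_trans (esym AE)).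
have AGE : \int[time_law]_s A s =
    \int[time_law]_s (if (s < t)%R then (G s)%:E else 0).
  by apply: ae_eq_integral => //; exact: mGt.
apply: (eq_trans AGE).
rewrite (time_integral t (fun s => (G s)%:E)); last exact/measurable_EFinP.
apply: eq_integral => s _; rewrite -EFinM; congr (_ * fine _)%:E.
by rewrite (integral_child_law hK hh xi xi0 _ d_gt0 (mE s)).
Qed.

End first_generation_densities.

Section cascade_solution.
Context {R : realType} {d : nat} {h : Rd R d -> R} {K : cascade_family R d}.
Hypothesis d_gt0 : (0 < d)%N.
Hypothesis hK : is_cascade h K.
Hypothesis hh : standard_majorizing_kernel h.
Variables (chi0 : Rd R d -> 'rV[complex R]_d) (f : R -> R).
Hypotheses (hchi0 : measurable_Cd chi0) (hf : class_S f).
Local Open Scope ereal_scope.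
Notation mtree := (@mtree R d).
Notation sample := (@sample R d K).
Notation mean := (@mean R d K).
Notation Y := (Yfun chi0 f).
Notation X := (Xfun chi0).
Notation N := (Nfun chi0).
Notation chi := (minimal_nFNS K chi0).
Notation idx := (bool * 'I_d)%type.
Notation mu1 := (@lebesgue_measure R).

Lemma rcoord_cintegral d' (S : measurableType d') (m : {measure set S ->
  \bar R})
    (A : set S) (g : S -> 'rV[complex R]_d) p :
  rcoord p (cintegral m A g) = (\int[m]_(x in A) rcoord p (g x))%R.
Proof. by rewrite /rcoord mxE; case: p.1. Qed.

Definition Xcoord (p : idx) (q : mtree * measurableTypeR R) : R :=
  rcoord p (X q).

Lemma rcoord_chi p eta r :
  rcoord p (chi eta r) = fine (@smean R d K (Xcoord p) eta r).
Proof. exact: rcoord_cintegral. Qed.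

Let mN := measurable_Nfun chi0 hchi0.
Let mXc p : measurable_fun setT (Xcoord p) := measurable_Xfun chi0 hchi0 p.
Let N0 := Nfun_ge0 chi0.

Lemma integrable_Xcoord p eta r : mean N eta r < +oo ->
  (cas_P K eta).-integrable setT (fun w => (Xcoord p (sample eta w, r))%:E).
Proof.
move=> Noo.
have iN : (cas_P K eta).-integrable setT (fun w => N (sample eta w, r)).
  apply/integrableP; split; first exact: measurable_sampled.
  by under eq_integral do rewrite gee0_abs//.
apply: (le_integrable measurableT _ _ iN).
  by apply: (measurable_sampled (fun q => (Xcoord p q)%:E));
    apply/measurable_EFinP.
move=> w _; rewrite [leRHS]gee0_abs// abse_EFin lee_fin.
exact: rcoord_le_cnorm.
Qed.

(** Test the mean against itself and apply Cauchy-Schwarz under the integral. *)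
Lemma cnorm_chi_le eta r : (cnorm (chi eta r))%:E <= mean N eta r.
Proof.
have Nm0 : 0 <= mean N eta r by exact: mean_ge0.
have [->|] := eqVneq (mean N eta r) +oo; first exact: leey.
rewrite -ltey => Noo; have iX p := integrable_Xcoord p eta r Noo.
set c := cnorm (chi eta r); have c0 : (0 <= c)%R := cnorm_ge0 _.
have [->//|cn0] := eqVneq c 0%R.
have cpos : (0 < c)%R by rewrite lt_neqAle eq_sym cn0.
have Nfin : mean N eta r \is a fin_num by rewrite ge0_fin_numE.
rewrite -(fineK Nfin) lee_fin -(ler_pM2l cpos).
have iN : (cas_P K eta).-integrable setT (fun w => N (sample eta w, r)).
  apply/integrableP; split; first exact: measurable_sampled.
  by under eq_integral do rewrite gee0_abs//.
pose x p w := Xcoord p (sample eta w, r).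
have -> : (c * c)%R = (\int[cas_P K eta]_w (\sum_p rcoord p (chi eta r)
  * x p w))%R.
  rewrite Rintegral_lincomb//;
    rewrite -expr2 {1}/c cnormE sqr_sqrtr ?sum_sqr_ge0//.
  by apply: eq_bigr => p _; rewrite expr2; congr (_ * _)%R; exact: rcoord_chi.
have -> : (c * fine (mean N eta r)
  = \int[cas_P K eta]_w (c * cnorm (X (sample eta w, r))))%R.
  by rewrite RintegralZl.
apply: le_Rintegral => //.
- exact: integrable_lincomb.
- exact: integrableZl measurableT c _ iN.
move=> w _; rewrite /c !cnormE; exact: cauchy_schwarz_sum.
Qed.

Variable xi : Rd R d.
Hypothesis xi0 : xi != 0%R.
Notation P := (cas_P K xi).
Notation tau_q := (giry_prod (@time_law R d K xi, @child_law R d K xi)).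
Notation rate := (enorm xi ^+ 2)%R.

(** The product in the integrand of the equation, when the first branching occurs
    at time [s]. *)
Definition branch_product (t s : R) (eta : Rd R d) : 'rV[complex R]_d :=
  (odot xi (chi eta (t - s)) (chi (xi - eta) (t - s)))%R.

Lemma measurable_branch_product t : obs_measurable rcoord_obs _ _
  (fun z : measurableTypeR R * Rd R d => branch_product t z.1 z.2).
Proof.
have mt : measurable_fun setT
    (fun z : measurableTypeR R * Rd R d => t - z.1 : measurableTypeR R)%R.
  by apply: measurable_funB => //; exact: measurable_cst.
apply: measurable_odot.
- exact: measurable_cst.
- move=> p; apply/measurable_EFinP; rewrite /=.
  under eq_fun do rewrite rcoord_chi.
  pose s (z : measurableTypeR R * Rd R d) : Rd R d * measurableTypeR R := (z.2,
    t - z.1)%R.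
  have ms : measurable_fun setT s by exact: measurable_fun_pair.
  exact: (measurableT_comp (measurable_smean hK _ (mXc p)) ms).
- move=> p; apply/measurable_EFinP; rewrite /=.
  under eq_fun do rewrite rcoord_chi.
  pose s (z : measurableTypeR R * Rd R d) : Rd R d * measurableTypeR R :=
    (xi - z.2, t - z.1)%R.
  have ms : measurable_fun setT s.
    apply: measurable_fun_pair => //.
    by apply: measurable_subRd => //; exact: measurable_cst.
  exact: (measurableT_comp (measurable_smean hK _ (mXc p)) ms).
Qed.

Variable t : R.
Hypothesis t_ge0 : (0 <= t)%R.
Hypothesis Yoo : mean Y xi t < +oo.

(** The integrand is dominated by a product of means of [N], and these integrate
    to the mean of the product of [N] over the two subtrees. *)
Lemma branch_product_lty :
  \int[mu1]_(s in `[0%R, t]) \int[leb d]_eta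
    (decay xi s * (cnorm (branch_product t s eta) * Hker h eta xi))%:E < +oo.
Proof.
have mB := measurable_cnorm _ _ _ (measurable_branch_product t).
rewrite -(ge0_first_step_integral d_gt0 hK hh xi xi0 t
  (fun s eta => cnorm (branch_product t s eta)) mB); last by move=> *;
    exact: cnorm_ge0.
apply: le_lt_trans (split_N_lty hK chi0 f hchi0 hf xi xi0 t Yoo).
rewrite (mean_branching hK xi xi0 t _ _ mN mN N0 N0).
apply: ge0_le_integral => //.
- by move=> z _; rewrite lee_fin; case: ifP => // _; exact: cnorm_ge0.
- apply/measurable_EFinP; apply: measurable_fun_ifT => //.
  exact: measurable_before.
- exact: (measurable_mean_product hK).
move=> z _; rewrite /mean_product; case: ifP => // _.
apply: (@le_trans _ _ ((cnorm (chi z.2 (t - z.1)%R))%:E * (cnorm (chi (xi -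
  z.2)%R (t - z.1)%R))%:E)).
  rewrite -EFinM lee_fin; apply: le_trans (cnorm_odot _ _ _) _.
  by rewrite ler_pdivrMr// ler_peMr ?mulr_ge0 ?cnorm_ge0// ler1n.
by apply: lee_pmul; rewrite ?lee_fin ?cnorm_ge0//; exact: cnorm_chi_le.
Qed.

Let split_coord_lty q r :
  \int[P]_w split_before t (abs_part (Xcoord q)) (abs_part (Xcoord r))
    (sample xi w) < +oo.
Proof.
apply: le_lt_trans (split_N_lty hK chi0 f hchi0 hf xi xi0 t Yoo).
have mabs p : measurable_fun setT (abs_part (Xcoord p)).
  by apply/measurable_EFinP; exact: measurableT_comp.
have abs0 p u : 0 <= abs_part (Xcoord p) u by rewrite lee_fin.
apply: ge0_le_integral => //.
- by move=> w _; exact: split_before_ge0.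
- exact: (measurableT_comp (measurable_split_before t _ _ (mabs q) (mabs r))
  (measurable_sample xi)).
- exact: (measurableT_comp (measurable_split_before t _ _ mN mN)
  (measurable_sample xi)).
move=> w _; rewrite /split_before; case: ifP => // _.
by apply: lee_pmul => //; rewrite lee_fin; exact: rcoord_le_cnorm.
Qed.

Let unsplit p (w : cas_Omega K xi) : R :=
  if (cas_T K xi [::] w < t)%R then 0%R else rcoord p (chi0 xi).

Let alive_set := [set w : cas_Omega K xi | (t <= cas_T K xi [::] w)%R].

Let measurable_alive_set : measurable alive_set.
Proof.
have -> : alive_set = setT `&` (cas_T K xi [::] @^-1` `[t, +oo[%classic).
  by apply/seteqP; split=> [w|w []]; rewrite /= in_itv/= andbT.
exact: measurable_cas_T.
Qed.

Let unsplitE p : unsplit p = (cst (rcoord p (chi0 xi))) \_ alive_set.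
Proof.
apply/funext => w; rewrite /unsplit patchE ltNge.
rewrite (_ : (w \in alive_set) = (t <= cas_T K xi [::] w)%R).
  by case: (t <= _)%R.
by apply/idP/idP; rewrite inE.
Qed.

Let integrable_unsplit p : P.-integrable setT (EFin \o unsplit p).
Proof.
rewrite unsplitE -restrict_EFin; apply/integrable_restrict => //.
by rewrite setTI; exact: finite_measure_integrable_cst.
Qed.

Let Rintegral_unsplit p :
  (\int[P]_w unsplit p w = expR (- t * rate) * rcoord p (chi0 xi))%R.
Proof.
rewrite unsplitE -Rintegral_mkcond Rintegral_cst// mulrC; congr (_ * _)%R.
transitivity (fine (expR (- t * rate))%:E) => //.
by congr fine; exact: (survival hK xi xi0 t t_ge0).
Qed.

(** Up to a null set, a component of [X] is a combination of products over the two
    subtrees, with the coefficients of [odot], plus the leaf term. *)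
Lemma chi_component p : (rcoord p (chi xi t) =
  expR (- t * rate) * rcoord p (chi0 xi) +
  \int[mu1]_(s in `[0, t]) (decay xi s *
    \int[leb d]_eta (Hker h eta xi * rcoord p (branch_product t s eta))))%R.
Proof.
pose c (i : idx * idx) := odot_coef xi p i.1 i.2.
pose g (i : idx * idx) w := ssplit t (Xcoord i.1) (Xcoord i.2) (sample xi w).
pose k (i : idx * idx) := @smean_product R d K xi t (Xcoord i.1) (Xcoord i.2).
have br i := signed_branching hK xi xi0 t _ _ (mXc i.1) (mXc i.2)
  (split_coord_lty i.1 i.2).
have ig i : P.-integrable setT (EFin \o g i) by have [] := br i.
have ik i : tau_q.-integrable setT (EFin \o k i) by have [] := br i.
have gk i : (\int[P]_w g i w = \int[tau_q]_z k i z)%R.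
  by congr fine; have [] := br i.
have odotE a b : rcoord p (odot xi a b)
  = (\sum_i c i * (rcoord i.1 a * rcoord i.2 b))%R.
  rewrite rcoord_odot pair_bigA/=.
  by apply: eq_bigr => i _.
have chiE : rcoord p (chi xi t)
  = (\int[P]_w (\sum_i c i * g i w + unsplit p w))%R.
  rewrite rcoord_cintegral; congr fine; apply: ae_eq_integral => //.
  - by apply: (measurable_sampled (fun q => (Xcoord p q)%:E));
    apply/measurable_EFinP.
  - apply: measurable_int (integrableD measurableT (integrable_lincomb _ _ _ _
    c g ig) (integrable_unsplit p)).
  have := positive_times_ae hK xi xi0; apply: filterS => w pw _; congr EFin.
  transitivity (rcoord p (X (sample xi w, t))) => //.
  rewrite Xfun_split// (sample_root hK xi xi0) /unsplit /g /ssplit.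
  rewrite (_ : (sample xi w [::]).2 = cas_T K xi [::] w)//.
  case: ifP => _; first by rewrite addr0 odotE.
  by rewrite big1 ?add0r// => i _; rewrite mulr0.
have kE : (fun z : measurableTypeR R * Rd R d => \sum_i c i * k i z)%R =
    (fun z => if z.1 < t then rcoord p (branch_product t z.1 z.2) else 0)%R.
  apply/funext => z; rewrite /k /smean_product; case: ifP => _.
    by rewrite odotE; apply: eq_bigr => i _; rewrite !rcoord_chi.
  by rewrite big1// => i _; rewrite mulr0.
rewrite chiE RintegralD//; last exact: integrable_lincomb.
rewrite Rintegral_unsplit addrC Rintegral_lincomb//; congr (_ + _)%R.
under eq_bigr do rewrite gk.
rewrite -(Rintegral_lincomb _ _ _ _ c k ik) kE.
apply: (Rintegral_first_step d_gt0 hK hh xi xi0 t (fun s eta =>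
  rcoord p (branch_product t s eta))).
  by apply/measurable_EFinP; exact: measurable_branch_product.
have := integrable_lincomb _ _ _ _ c k ik.
by rewrite (_ : (fun x => (\sum_i c i * k i x)%:E) = EFin \o (fun x =>
  \sum_i c i * k i x)%R)// kE.
Qed.

Lemma minimal_nFNS_solves : solves_nFNS_at h chi0 chi xi t.
Proof.
split; first exact: branch_product_lty.
apply: rcoord_inj => p; rewrite rcoordD rcoordZ rcoord_cintegral chi_component.
congr (_ + _)%R; apply: eq_Rintegral => s _; rewrite rcoordZ rcoord_cintegral.
by congr (_ * _)%R; apply: eq_Rintegral => eta _; rewrite rcoordZ.
Qed.

End cascade_solution.

(** * Finiteness at all times, and the theorem *)

Section finiteness.
Context {R : realType} {d : nat} {h : Rd R d -> R} {K : cascade_family R d}.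
Hypothesis d_gt0 : (0 < d)%N.
Hypothesis hK : is_cascade h K.
Variables (chi0 : Rd R d -> 'rV[complex R]_d) (f : R -> R).
Hypotheses (hchi0 : measurable_Cd chi0) (hf : class_S f).
Notation mean_Y := (@mean R d K (Yfun chi0 f)).

(** Only the contribution of the branched trees can be infinite. *)
Lemma mean_Y_lty_le (xi : Rd R d) t t' : xi != 0 -> t <= t' ->
  (mean_Y xi t' < +oo)%E -> (mean_Y xi t < +oo)%E.
Proof.
move=> xi0 tt' /(split_Y_lty hK chi0 f hchi0 hf xi xi0).
have mY := measurable_Yfun chi0 f hchi0 hf.
have Y0 := Yfun_ge0 chi0 f hf.
rewrite (mean_branching hK xi xi0 t' _ _ mY mY Y0 Y0).
move=> /(mean_product_lty_le hK xi xi0 _ _ mY mY Y0 Y0 t t' tt').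
rewrite -(mean_branching hK xi xi0 t _ _ mY mY Y0 Y0) => Yoo.
rewrite (mean_Y_split hK chi0 f hchi0 hf xi xi0 t) lte_add_pinfty//.
exact: unsplit_term_lty.
Qed.

Definition finite_points (T : \bar R) : set (Rd R d) :=
  [set xi | xi != 0 /\
     forall t, 0 <= t -> (t%:E < T)%E -> (mean_Y xi t < +oo)%E].

(** By Fubini almost every [xi] has almost every time in [0, T) finite, and a
    finite time makes all earlier ones finite. *)
Lemma finite_points_full (T : \bar R) :
  {ae (leb d \x lebesgue_measure)%E, forall p : Rd R d * R, 0 <= p.2 ->
     (p.2%:E < T)%E -> (mean_Y p.1 p.2 < +oo)%E} ->
  (leb d).-negligible (~` finite_points T).
Proof.
move=> [N [mN N0 subN]].
have mS : measurable_fun setT (fun x : Rd R d =>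
    (lebesgue_measure : {measure set (measurableTypeR R) -> \bar R})
      (xsection N x)).
  exact: measurable_fun_xsection.
have /(ae_eq_integral_abs (leb d) measurableT mS).1 :
    (\int[leb d]_x `|lebesgue_measure (xsection N x)| = 0)%E.
  under eq_integral do rewrite gee0_abs//.
  exact: N0.
move=> [M [mM M0 subM]].
exists (M `|` [set 0]); split.
- by apply: measurableU => //; exact: measurable_set1_Rd.
- by rewrite measureU0//; [exact: measurable_set1_Rd|exact: leb_set1].
move=> xi /= nfin; apply: contrapT => /not_orP[nM /eqP xi0]; apply: nfin;
  split=> //.
have {nM} secN : lebesgue_measure (xsection N xi) = 0%E.
  by apply: contrapT => sN; apply: nM; apply: subM => /= H; apply: sN; exact: H.
move=> t t0 tT.
have [b tb bT] : exists2 b, t < b & (b%:E <= T)%E.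
  move: tT; case: (T) => [r||]//; first by rewrite lte_fin; exists r.
  by exists (t + 1); rewrite ?ltrDl// leey.
have [t' tt'b Nt'] : exists2 t', t < t' < b & ~ N (xi, t').
  apply: contrapT => none.
  have sub : `]t, b[%classic `<=` xsection N xi.
    move=> t'; rewrite /= in_itv/= => tt'b; rewrite /xsection/= inE.
    by apply: contrapT => Nt'; apply: none; exists t'.
  have : (lebesgue_measure `]t,
    b[%classic <= lebesgue_measure (xsection N xi))%E.
    by apply: le_measure => //; rewrite inE;
      [exact: measurable_itv|exact: measurable_xsection].
  by rewrite secN lebesgue_measure_itv/= lte_fin tb -EFinB lee_fin subr_le0
    leNgt tb.
move/andP: tt'b => [tt' t'b].
apply: (mean_Y_lty_le xi t t' xi0 (ltW tt')).
apply: contrapT => noo; apply: Nt'; apply: subN => /= H; apply: noo.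
apply: (H (le_trans t0 (ltW tt'))).
by apply: lt_le_trans bT; rewrite lte_fin.
Qed.

End finiteness.

Theorem theorem3p4 (R : realType) (d : nat) (hd : (3 <= d)%N)
  (h : Rd R d -> R) (hh : standard_majorizing_kernel h)
  (K : cascade_family R d) (hK : is_cascade h K)
  (chi0 : Rd R d -> 'rV[complex R]_d) (hchi0 : measurable_Cd chi0)
  (f : R -> R) (hf : class_S f)
  (phi : Rd R d -> R -> \bar R)
  (hphi : phi = minimal_nFMS K (fun xi => (f (cnorm (chi0 xi) / 2))%:E))
  (T : \bar R) (hT : (0 < T)%E)
  (hfin : {ae (leb d \x lebesgue_measure)%E,
     forall p : Rd R d * R, 0 <= p.2 -> (p.2%:E < T)%E ->
       (phi p.1 p.2 < +oo)%E}) :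
  exists D : set (Rd R d),
    [/\ (leb d).-negligible (~` D),
        D `<=` [set xi | xi != 0],
        has_minimal_nFNS_on h K chi0
          (D `*` [set t | 0 <= t /\ (t%:E < T)%E]) &
        forall xi t, D xi -> 0 <= t -> (t%:E < T)%E ->
          (phi xi t < +oo)%E /\
          cnorm (minimal_nFNS K chi0 xi t) <= 2 * inv_S f (fine (phi xi t))].
Proof.
have d0 : (0 < d)%N by exact: leq_trans hd.
have phiE xi t : phi xi t = @mean R d K (Yfun chi0 f) xi t by rewrite hphi.
exists (@finite_points R d K chi0 f T); split.
- apply: (finite_points_full d0 hK chi0 f hchi0 hf).
  by move: hfin; rewrite hphi.
- by move=> xi [].
- move=> xi t [[xi0 fin] [t0 tT]]; split.
    exact: (mean_N_lty chi0 f hchi0 hf xi t (fin t t0 tT)).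
  exact: (minimal_nFNS_solves d0 hK hh chi0 f hchi0 hf xi xi0 t t0 (fin t t0 tT)).
move=> xi t [xi0 fin] t0 tT; have Yoo := fin t t0 tT; rewrite phiE; split => //.
apply: le_trans (jensen_N chi0 f hchi0 hf xi t Yoo).
have Noo := mean_N_lty chi0 f hchi0 hf xi t Yoo.
rewrite -lee_fin fineK; first exact: cnorm_chi_le.
rewrite ge0_fin_numE//; apply: mean_ge0 => p; exact: Nfun_ge0.
Qed.
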